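(* Let $(M,\tau)$ be a finite von Neumann algebra with a trace and let $A=A^*\in M$ be an integer operator. Let $R_A(\lambda)=\tau(p_\lambda)$, where $p_\lambda$ is the spectral projection of $A$ corresponding to $(-\infty,\lambda)$, be the distribution function of the spectral measure of $A$. Then $R_A=R_A^a+R_A^c$, where (i) $R_A^a$ is a step function whose set of jump points consists of full sets of Galois conjugates of totally real algebraic integers (i.e. all jump points are totally real algebraic integers, and with any jump point all its Galois conjugates are jump points), and (ii) $R_A^c$ is a continuous function which, suitably normalized (i.e. up to a non-negative scalar factor), is the uniform limit of distribution functions of finite convex combinations of measures $\mu_{\alpha_i}$, where each $\alpha_i$ is a totally real algebraic integer.
   Context: $\tau$ is a faithful normal trace with $\tau(1)=1$. The spectral measure of a normal operator $a\in M$ is the probability measure $B\mapsto\tau(1_B(a))$ on $\mathbb{C}$; the spectral measure of a normal $k\times k$ matrix is taken with respect to the normalized trace on $M_k(\mathbb{C})$. A normal operator $a\in M$ is called integer if its spectral measure is a weak limit of the spectral measures of a sequence of normal matrices with entries in $\mathbb{Z}$ (of possibly varying sizes) which is uniformly bounded in operator norm. An algebraic integer is totally real if it and all its Galois conjugates are real. For a totally real algebraic integer $\alpha$, $\mu_\alpha$ denotes the sum of the Dirac measures of weight $\deg(\alpha)^{-1}$ at the Galois conjugates of $\alpha$ (including $\alpha$). The distribution function of a finite measure $\nu$ on $\mathbb{R}$ is $\lambda\mapsto\nu((-\infty,\lambda))$. *)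

(* Defs.v *)
From HB Require Import structures.
From mathcomp Require Import all_boot all_order all_algebra.
From mathcomp Require Import complex.
From mathcomp Require Import all_classical all_reals all_analysis.

Set Implicit Arguments.
Unset Strict Implicit.
Unset Printing Implicit Defensive.

Import Order.TTheory GRing.Theory Num.Theory.
Import numFieldNormedType.Exports.

Local Open Scope classical_set_scope.
Local Open Scope complex_scope.
Local Open Scope ring_scope.

(* The complex numbers with their Borel sigma-algebra; the topology of R[i] is
   the one of the regular module R[i]^o, given by the modulus. *)
Definition borelC (R : realType) :=
  g_sigma_algebraType (open : set (set (R[i]^o))).

Section VonNeumannAlgebras.
Variables (R : realType) (H : completeNormedModType R[i]).
Variable ip : {dot H for Num.conj}.
(* ip is linear in its first argument and conjugate-linear in the second. *)

Definition hilbert_norm : Prop := forall x : H, `|x| ^+ 2 = ip x x.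

Definition bounded_operator (a : H -> H) : Prop :=
  linear a /\ exists K : R[i], forall x, `|a x| <= K * `|x|.

Definition adjoint_of (a b : H -> H) : Prop :=
  forall x y, ip (a x) y = ip x (b y).

Definition self_adjoint (a : H -> H) : Prop := adjoint_of a a.

Definition normal_op (a : H -> H) : Prop :=
  exists b : H -> H, adjoint_of a b /\ a \o b = b \o a.

(* On R[i], 0 <= z says that z is real and nonnegative. *)
Definition op_le (a b : H -> H) : Prop := forall x, 0 <= ip (b x - a x) x.

Definition positive_op (a : H -> H) : Prop := op_le (fun=> 0) a.

Definition commutant (S : set (H -> H)) : set (H -> H) :=
  [set b | bounded_operator b /\ forall a, S a -> a \o b = b \o a].

Definition von_neumann_algebra (M : set (H -> H)) : Prop :=
  [/\ M `<=` bounded_operator,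
      forall a, M a -> exists2 b, M b & adjoint_of a b
    & commutant (commutant M) = M].

(* a is the least upper bound of D in the self-adjoint part of M. *)
Definition op_lub (M D : set (H -> H)) (a : H -> H) : Prop :=
  [/\ M a, self_adjoint a, forall b, D b -> op_le b a
    & forall c, M c -> self_adjoint c -> (forall b, D b -> op_le b c) ->
        op_le a c].

Definition directed (D : set (H -> H)) : Prop :=
  D !=set0 /\
  forall b c, D b -> D c -> exists d, [/\ D d, op_le b d & op_le c d].

(* The values of tau outside M are irrelevant. *)
Record faithful_normal_trace (M : set (H -> H)) (tau : (H -> H) -> R[i]) :
    Prop := {
  trace_linear : forall (c : R[i]) a b, M a -> M b ->
    tau (fun x => c *: a x + b x) = c * tau a + tau b ;
  trace_comm : forall a b, M a -> M b -> tau (a \o b) = tau (b \o a) ;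
  trace_positive : forall a, M a -> positive_op a -> 0 <= tau a ;
  trace_faithful : forall a, M a -> positive_op a -> tau a = 0 ->
    a = (fun=> 0) ;
  trace_normal : forall D a, D `<=` M -> D `<=` positive_op -> directed D ->
    op_lub M D a ->
    isLub [set complex.Re (tau b) | b in D] (complex.Re (tau a)) ;
  trace_one : tau id = 1
}.

(* B |-> <E(B) x, x> *)
Definition diag_measure (E : set (borelC R) -> H -> H) (x : H)
    (B : set (borelC R)) : \bar R := (complex.Re (ip (E B x) x))%:E.

(* E is the projection-valued measure B |-> 1_B(a) of the normal operator a of
   M: E is an M-valued spectral measure on the Borel subsets of C, and
   a = \int z dE(z) weakly, i.e. <a x, x> = \int z d<E(z) x, x> for all x (real
   and imaginary parts are written separately). By the spectral theorem, E
   exists and its restriction to the Borel sets is determined by a. *)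
Record spectral_resolution (M : set (H -> H)) (a : H -> H)
    (E : set (borelC R) -> H -> H) : Prop := {
  spectral_in : forall B, measurable B -> M (E B) ;
  spectral_self_adjoint : forall B, measurable B -> self_adjoint (E B) ;
  spectral_setT : E setT = id ;
  spectral_setI : forall B C, measurable B -> measurable C ->
    E (B `&` C) = E B \o E C ;
  spectral_sigma_additive : forall B : nat -> set (borelC R),
    (forall n, measurable (B n)) -> trivIset setT B ->
    forall x, (fun n => \sum_(0 <= i < n) E (B i) x) @ \oo
                --> E (\bigcup_n B n) x ;
  spectral_integrable : forall x,
    (diag_measure E x).-integrable setT
      (fun z : borelC R => (complex.Re z)%:E) /\
    (diag_measure E x).-integrable setT
      (fun z : borelC R => (complex.Im z)%:E) ;
  spectral_integral_Re : forall x,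
    (\int[diag_measure E x]_z (complex.Re z)%:E =
     (complex.Re (ip (a x) x))%:E)%E ;
  spectral_integral_Im : forall x,
    (\int[diag_measure E x]_z (complex.Im z)%:E =
     (complex.Im (ip (a x) x))%:E)%E
}.

(* B |-> tau(1_B(a)) *)
Definition spectral_measure (tau : (H -> H) -> R[i])
    (E : set (borelC R) -> H -> H) (B : set (borelC R)) : \bar R :=
  (complex.Re (tau (E B)))%:E.

End VonNeumannAlgebras.

Section IntegerOperators.
Variable R : realType.

(* 1_B(A) for a normal matrix A = P^-1 D P (P unitary, D diagonal) *)
Definition mx_spectral_proj k (A : 'M[R[i]]_k) (B : set (borelC R)) :
    'M[R[i]]_k :=
  invmx (spectralmx A) *m diag_mx (map_mx \1_B (spectral_diag A))
    *m spectralmx A.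

Definition mx_spectral_measure k (A : 'M[R[i]]_k) (B : set (borelC R)) :
    \bar R :=
  (complex.Re (k%:R^-1 * \tr (mx_spectral_proj A B)))%:E.

(* K bounds the operator norm of A on C^k with its Euclidean norm. *)
Definition mx_opnorm_le k (A : 'M[R[i]]_k) (K : R) : Prop :=
  0 <= K /\
  forall v : 'cV[R[i]]_k,
    \sum_i `|(A *m v) i 0| ^+ 2 <= (K ^+ 2)%:C * \sum_i `|v i 0| ^+ 2.

Definition weakly_converges (mu : nat -> set (borelC R) -> \bar R)
    (nu : set (borelC R) -> \bar R) : Prop :=
  forall f : R[i]^o -> R, continuous f ->
    (exists K : R, forall z, `|f z| <= K) ->
    (\int[mu n]_(z in [set: borelC R]) (f z)%:E @[n --> \oo]
       --> \int[nu]_(z in [set: borelC R]) (f z)%:E)%E.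

(* a is a normal operator of M, with spectral resolution E, and is integer. *)
Definition integer_operator (H : completeNormedModType R[i])
    (ip : {dot H for Num.conj}) (M : set (H -> H)) (tau : (H -> H) -> R[i])
    (a : H -> H) (E : set (borelC R) -> H -> H) : Prop :=
  [/\ M a, normal_op ip a, spectral_resolution ip M a E
    & exists (k : nat -> nat) (X : forall n, 'M[int]_(k n)),
        let XC n : 'M[R[i]]_(k n) := map_mx intr (X n) in
        [/\ forall n, (0 < k n)%N,
            forall n, XC n \is normalmx,
            exists K, forall n, mx_opnorm_le (XC n) K
          & weakly_converges (fun n => mx_spectral_measure (XC n))
              (spectral_measure tau E)]].

Definition spectral_distribution (H : completeNormedModType R[i])
    (tau : (H -> H) -> R[i]) (E : set (borelC R) -> H -> H) (l : R) : R :=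
  complex.Re (tau (E [set x%:C | x in `]-oo, l[%classic])).

End IntegerOperators.

Section TotallyRealIntegers.
Variable R : realType.

(* The minimal polynomial over the rationals, or 0 if z is transcendental *)
Definition minpolyQ (z : R[i]) : {poly rat} :=
  xget 0 [set p | [/\ p \is monic, irreducible_poly p
                    & root (map_poly ratr p) z]].

Definition algebraic_degree (z : R[i]) : nat := (size (minpolyQ z)).-1.

Definition galois_conjugate (z w : R[i]) : Prop :=
  root (map_poly ratr (minpolyQ z)) w.

Definition totally_real_integer (a : R) : Prop :=
  integralOver (intr : int -> R[i]) a%:C /\
  forall w, galois_conjugate a%:C w -> complex.Im w = 0.

Definition galois_measure (a : R) (B : set R) : \bar R :=
  (\sum_(b \in [set b : R | galois_conjugate a%:C b%:C])
     ((algebraic_degree a%:C)%:R^-1 : R)%:E * \d_b B)%E.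

Definition distribution_function (nu : set R -> \bar R) (l : R) : R :=
  fine (nu `]-oo, l[%classic).

Definition galois_convex_combination (nu : set R -> \bar R) : Prop :=
  exists (m : nat) (c a : 'I_m -> R),
    [/\ forall i, 0 <= c i, \sum_i c i = 1,
        forall i, totally_real_integer (a i)
      & nu = fun B => (\sum_i (c i)%:E * galois_measure (a i) B)%E].

(* The jumps of a step function may be infinitely many, and even dense: F is
   the left-continuous sum of its jumps, of nonnegative and summable sizes. *)
Definition step_function (F : R -> R) : Prop :=
  exists w : R -> R,
    [/\ forall x, 0 <= w x,
        (\esum_(x in [set: R]) (w x)%:E < +oo)%E
      & forall l, ((F l)%:E = \esum_(x in `]-oo, l[%classic) (w x)%:E)%E].

Definition jump_point (F : R -> R) (x : R) : Prop := ~ {for x, continuous F}.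

End TotallyRealIntegers.

(* Main.v *)
Require Import Defs.
From HB Require Import structures.
From mathcomp Require Import all_boot all_order all_algebra.
From mathcomp Require Import complex mxtens finmap qpoly.
From mathcomp Require Import zify ring lra.
From mathcomp Require Import all_classical all_reals all_analysis measurable_realfun.
Set Implicit Arguments.
Unset Strict Implicit.
Unset Printing Implicit Defensive.
Import Order.TTheory GRing.Theory Num.Theory.
Import numFieldNormedType.Exports.
Local Open Scope classical_set_scope.
Local Open Scope complex_scope.
Local Open Scope ring_scope.

(** Everything rests on one remark about integer matrices. If an integer matrix is
diagonal in some complex basis, then the lowest nonzero coefficient of its characteristic
polynomial is a nonzero integer and is, up to sign, the product of the nonzero
eigenvalues; that product therefore has modulus at least 1. Hence, if all eigenvalues
have modulus at most B > 1, at most a proportion 1/r of them is nonzero of modulus at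
most B^-r [int_conj_diag_few_small]. For normal integer matrices X and Y this applies to
  - X (x) 1 - 1 (x) Y, whose eigenvalues are the differences z - w: few pairs of
    eigenvalues of X and Y are close without being equal [spectrum_separated];
  - X - X^T, whose eigenvalues are the z - conj z: few eigenvalues of X are close to
    the real line without being real [spectrum_few_nonreal].
Moreover the real eigenvalues of X are totally real algebraic integers
[spectrum_totally_real], and conjugate numbers are eigenvalues of X of the same
multiplicity [spectrum_count_conjugate].

Let F be the distribution function of A, the limit of the matrices X_n. Normality of the
trace makes B |-> tau(1_B(A)) a measure, and since A is self-adjoint it lives on the real
line; with [spectrum_few_nonreal], weak convergence says that the proportion of real
eigenvalues of X_n below l tends to F l, up to an arbitrarily small shift of l. The shift
can be removed. Let x be an atom of the limit measure. The spectrum of X_n has about the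
mass of x near x. For fixed n, choose p so large that the spectrum of X_p has the mass of
x within a distance of x much smaller than that of any eigenvalue of X_n other than x.
The eigenvalues of X_n near but different from x then form close but unequal pairs with
those of X_p, so there are few of them: the mass of X_n near x sits at x itself, and the
frequency of the eigenvalue x in X_n tends to the mass of x [cvg_freq_jump]. So x is an
eigenvalue of integer matrices, hence totally real, and its conjugates have the same
frequencies in every X_n, hence are atoms of the same mass [jump_conj]. This is the
statement on the step function R^a, the sum of the jumps of F.

The difference R^c of F and R^a is increasing and continuous. To approximate it, delete
from the spectrum of X_n the finitely many points at which F jumps by at least some small
threshold. The proportion of the other real eigenvalues below l is then close to R^c at
finitely many prescribed values of l when n is large, hence everywhere, both functions
being monotone and the limit continuous [Fc_approx_unnormalized]. The deleted set is
closed under conjugation, so what is left still contains conjugate numbers equally often;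
its normalized counting measure is the average of the measures mu_a over its entries a
[sum_galois_measure]. *)

(** * Integer matrices that are diagonal in a complex basis *)

Lemma char_poly_conj_diag (C : fieldType) m (A P : 'M[C]_m) (y : 'rV[C]_m) :
  P \in unitmx -> A = invmx P *m diag_mx y *m P ->
  char_poly A = \prod_i ('X - (y 0 i)%:P).
Proof.
move=> uP ->; transitivity (char_poly (diag_mx y)); last first.
  rewrite char_poly_trig; last exact/diag_mx_is_trig.
  by apply: eq_bigr => i _; rewrite mxE eqxx mulr1n.
rewrite /char_poly /char_poly_mx.
have uPX : map_mx polyC P \in unitmx by rewrite map_unitmx.
have -> : 'X%:M - map_mx polyC (invmx P *m diag_mx y *m P) =
   invmx (map_mx polyC P) *m ('X%:M - map_mx polyC (diag_mx y)) *m map_mx polyC P.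
  rewrite mulmxBr mulmxBl !map_mxM map_invmx; congr (_ - _).
  by rewrite scalar_mxC mulmxKV.
by rewrite !det_mulmx mulrC mulrA -det_mulmx mulmxV // det1 mul1r.
Qed.

(** Up to sign the product is the lowest nonzero coefficient of the characteristic
polynomial of Y, a nonzero integer. *)
Lemma int_conj_diag_prod_ge1 (C : numFieldType) m (Y : 'M[int]_m)
    (P : 'M[C]_m) (y : 'rV[C]_m) :
  P \in unitmx -> map_mx intr Y = invmx P *m diag_mx y *m P ->
  1 <= \prod_(i | y 0 i != 0) `|y 0 i|.
Proof.
move=> uP /(char_poly_conj_diag uP).
rewrite -map_char_poly (bigID (fun i => y 0 i == 0)) /=.
rewrite (eq_bigr (fun=> 'X)); last by move=> i /eqP ->; rewrite subr0.
rewrite big_const iter_mulr_1 => /(congr1 (fun p : {poly C} => p`_(#|[pred i | y 0 i == 0]|))).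
rewrite coef_map /= coefXnM ltnn subnn -horner_coef0 horner_prod.
rewrite (eq_bigr (fun i => - y 0 i)); last by move=> i _; rewrite hornerXsubC sub0r.
set c := (char_poly Y)`_ _ => cE.
have prodE : \prod_(i | y 0 i != 0) `|y 0 i| = (`|c|%:~R : C).
  rewrite intr_norm cE normr_prod; apply: eq_bigr => i _; by rewrite normrN.
rewrite prodE -[1]/(1%:~R) ler_int.
suff : c != 0 by move=> c0; rewrite -gtz0_ge1 normr_gt0.
apply: contraTneq isT => c0; have : \prod_(i | y 0 i != 0) `|y 0 i| != 0.
  by apply/prodf_neq0 => i; rewrite normr_eq0.
by rewrite prodE c0 normr0 eqxx.
Qed.

(** Each of the s nonzero eigenvalues of modulus at most B^-r contributes at most B^-r to
the product of the nonzero eigenvalues, and each of the others at most B; the product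
being at least 1, B^(rs) is at most B^m. *)
Lemma int_conj_diag_few_small (C : numFieldType) m (Y : 'M[int]_m)
    (P : 'M[C]_m) (y : 'rV[C]_m) (B : C) (r : nat) :
  P \in unitmx -> map_mx intr Y = invmx P *m diag_mx y *m P ->
  1 < B -> (forall i, `|y 0 i| <= B) ->
  (r * #|[pred i | (y 0%R i != 0%R) && (`|y 0%R i| <= B ^- r)%R]| <= m)%N.
Proof.
move=> uP YE B1 yB; have B0 : 0 < B by exact: lt_trans B1.
have := int_conj_diag_prod_ge1 uP YE.
rewrite (bigID (fun i => `|y 0 i| <= B ^- r)) /=.
set S := [pred i | _ & _]; move=> le1.
have h1 : \prod_(i | (y 0 i != 0) && (`|y 0 i| <= B ^- r)) `|y 0 i| <= (B ^- r) ^+ #|S|.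
  rewrite -prodr_const; apply: ler_prod => i /andP[_ ->]; by rewrite normr_ge0.
have h2 : \prod_(i | (y 0 i != 0) && ~~ (`|y 0 i| <= B ^- r)) `|y 0 i| <= B ^+ m.
  apply: (@le_trans _ _ (\prod_(i | (y 0 i != 0) && ~~ (`|y 0 i| <= B ^- r)) B)).
    by apply: ler_prod => i _; rewrite normr_ge0 yB.
  rewrite prodr_const ler_eXn2l // (leq_trans (max_card _)) // card_ord //.
have : 1 <= (B ^- r) ^+ #|S| * B ^+ m.
  apply: le_trans le1 _; apply: ler_pM => //; apply: prodr_ge0 => //.
rewrite exprVn -exprM mulrC ler_pdivlMr ?exprn_gt0 // mul1r.
by rewrite ler_eXn2l.
Qed.

Lemma tens11 (F : pzRingType) k l : (1%:M : 'M[F]_k) *t (1%:M : 'M[F]_l) = 1%:M.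
Proof.
apply/matrixP => i j.
case: (mxtens_indexP i) => [i1 i2]; case: (mxtens_indexP j) => [j1 j2].
rewrite tensmxE !mxE -natrM mulnb (can_eq (@mxtens_indexK k l)); by rewrite xpair_eqE.
Qed.

(** The tensor product of an eigenvector of X and one of Y is an eigenvector of
X (x) 1 - 1 (x) Y, for the difference of the two eigenvalues. *)
Lemma tens_diff_conj_diag (F : fieldType) k l (X P : 'M[F]_k) (Y Q : 'M[F]_l)
    (x : 'rV[F]_k) (y : 'rV[F]_l) :
  P \in unitmx -> Q \in unitmx ->
  X = invmx P *m diag_mx x *m P -> Y = invmx Q *m diag_mx y *m Q ->
  P *t Q \in unitmx /\
  X *t 1%:M - 1%:M *t Y = invmx (P *t Q) *m
    diag_mx (\row_p (x 0 (mxtens_unindex p).1 - y 0 (mxtens_unindex p).2))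
    *m (P *t Q).
Proof.
move=> uP uQ XE YE.
have PQV : (invmx P *t invmx Q) *m (P *t Q) = 1%:M.
  by rewrite tensmx_mul !mulVmx // tens11.
have [_ uPQ] := mulmx1_unit PQV; split=> //.
have -> : invmx (P *t Q) = invmx P *t invmx Q.
  by rewrite -[LHS]mul1mx -PQV mulmxK.
have -> : diag_mx (\row_p (x 0 (mxtens_unindex p).1 - y 0 (mxtens_unindex p).2)) =
    diag_mx x *t 1%:M - 1%:M *t diag_mx y.
  apply/matrixP => i j.
  case: (mxtens_indexP i) => [i1 i2]; case: (mxtens_indexP j) => [j1 j2].
  rewrite !mxE !mxtens_indexK (can_eq (@mxtens_indexK k l)) xpair_eqE /=.
  case: (i1 == j1); case: (i2 == j2);
    by rewrite /= ?(mulr0n, mulr1n, mulr0, mul0r, mulr1, mul1r, subr0, sub0r, oppr0).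
rewrite mulmxBr mulmxBl !tensmx_mul !mulmx1 !mulVmx // -XE -YE //.
Qed.

(** * Spectra of normal integer matrices *)

Section Spectrum.
Variable R : realType.
Local Notation C := R[i].

Definition spectrum k (X : 'M[int]_k) : seq C :=
  [seq spectral_diag (map_mx intr X : 'M[C]_k) 0 j | j <- enum 'I_k].

Lemma size_spectrum k (X : 'M[int]_k) : size (spectrum X) = k.
Proof. by rewrite size_map size_enum_ord. Qed.

Lemma spectral_decomposition k (X : 'M[int]_k) (XC := map_mx intr X : 'M[C]_k) :
  XC \is normalmx ->
  XC = invmx (spectralmx XC) *m diag_mx (spectral_diag XC) *m spectralmx XC.
Proof. by move=> /orthomx_spectralP. Qed.

Lemma char_poly_spectrum k (X : 'M[int]_k) :
  (map_mx intr X : 'M[C]_k) \is normalmx ->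
  map_poly intr (char_poly X) = \prod_(z <- spectrum X) ('X - z%:P).
Proof.
move=> nX; rewrite map_char_poly.
rewrite (char_poly_conj_diag (spectral_unit _) (spectral_decomposition nX)).
by rewrite big_map big_enum.
Qed.

Lemma mem_spectrum k (X : 'M[int]_k) z : z \in spectrum X ->
  exists i, z = spectral_diag (map_mx intr X : 'M[C]_k) 0 i.
Proof. by move=> /mapP[i _ ->]; exists i. Qed.

Lemma mem_spectral_diag k (X : 'M[int]_k) i :
  spectral_diag (map_mx intr X : 'M[C]_k) 0 i \in spectrum X.
Proof. by rewrite map_f ?mem_enum. Qed.

Lemma spectrum_bounded k (X : 'M[int]_k) (K : R) z :
  (map_mx intr X : 'M[C]_k) \is normalmx ->
  mx_opnorm_le (map_mx intr X : 'M[C]_k) K -> z \in spectrum X -> `|z| <= K%:C.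
Proof.
move=> nX [K0 bK] /mem_spectrum[i ->].
set XC := map_mx intr X; set P := spectralmx XC; set y := spectral_diag XC.
have uP : P \in unitmx by exact: spectral_unit.
have XE : XC = invmx P *m diag_mx y *m P by exact: spectral_decomposition.
(* An eigenvector for the i-th eigenvalue. *)
pose v := invmx P *m delta_mx i (0 : 'I_1).
have Xv : XC *m v = y 0 i *: v.
  rewrite /v {1}XE !mulmxA (mulmxK uP) -mulmxA.
  have -> : y 0 i *: (invmx P *m delta_mx i 0) = invmx P *m (y 0 i *: delta_mx i (0 : 'I_1)).
    by rewrite -scalemxAr.
  congr (_ *m _).
  apply/matrixP => j l; rewrite mul_diag_mx !mxE.
  by case: eqVneq => [->|_] //; rewrite !mulr0.
have := bK v; rewrite Xv.
under eq_bigr do rewrite mxE normrM exprMn.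
rewrite -mulr_sumr.
have vpos : 0 < \sum_j `|v j 0| ^+ 2.
  rewrite lt_neqAle sumr_ge0 ?andbT; last by move=> *; exact: exprn_ge0.
  rewrite eq_sym; apply/negP => /eqP /psumr_eq0P H.
  have v0 : v = 0.
    apply/matrixP => j l; rewrite ord1 [RHS]mxE; apply/eqP; rewrite -normr_eq0 -sqrf_eq0.
    by rewrite H // => *; exact: exprn_ge0.
  have : P *m v = 0 by rewrite v0 mulmx0.
  rewrite mulmxA mulmxV // mul1mx => /matrixP/(_ i 0); rewrite !mxE !eqxx => /eqP.
  by rewrite oner_eq0.
rewrite ler_pM2r // => h.
rewrite -(@ler_pXn2r _ 2) // ?nnegrE ?ler0c //; apply: le_trans h _.
by rewrite rmorphXn.
Qed.

(** The pairs of an eigenvalue in a and one in b give as many small nonzero eigenvalues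
of the integer matrix X (x) 1 - 1 (x) Y. *)
Lemma spectrum_separated k (X : 'M[int]_k) l (Y : 'M[int]_l) (K B : R) r (a b : pred C) :
  (map_mx intr X : 'M[C]_k) \is normalmx -> (map_mx intr Y : 'M[C]_l) \is normalmx ->
  (forall z, z \in spectrum X -> `|z| <= K%:C) ->
  (forall z, z \in spectrum Y -> `|z| <= K%:C) ->
  1 < B -> K + K <= B ->
  (forall z w, a z -> b w -> z != w /\ `|z - w| <= (B ^- r)%:C) ->
  (r * (count a (spectrum X) * count b (spectrum Y)) <= k * l)%N.
Proof.
move=> nX nY bX bY B1 KB ab.
set XC : 'M[C]_k := map_mx intr X; set YC : 'M[C]_l := map_mx intr Y.
have uP : spectralmx XC \in unitmx by exact: spectral_unit.
have uQ : spectralmx YC \in unitmx by exact: spectral_unit.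
have := tens_diff_conj_diag uP uQ (spectral_decomposition nX) (spectral_decomposition nY).
rewrite -/XC -/YC.
set x := spectral_diag XC; set y := spectral_diag YC; set d := \row_p _ => -[uPQ dE].
have intE : map_mx intr (X *t 1%:M - 1%:M *t Y) = XC *t 1%:M - 1%:M *t YC :> 'M[C]_(k * l).
  by rewrite map_mxD map_mxN !map_mxT !map_mx1.
have B1' : 1 < B%:C :> C by rewrite -[1]/(1%:C) ltcR.
have bd i : `|d 0 i| <= B%:C.
  rewrite mxE (le_trans (ler_normB _ _)) // (@le_trans _ _ (K + K)%:C) ?lecR // rmorphD /=.
  by apply: lerD; [apply: bX | apply: bY]; exact: mem_spectral_diag.
have := int_conj_diag_few_small r uPQ (etrans intE dE) B1' bd.
apply: leq_trans; rewrite leq_mul2l; apply/orP; right.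
have cE m (p : pred C) (f : 'I_m -> C) :
    count p [seq f j | j <- enum 'I_m] = #|[pred j | p (f j)]|.
  rewrite count_map cardE size_filter count_filter; apply: eq_count => j.
  by rewrite !inE andbT.
rewrite !cE -cardX.
rewrite -(fintype.card_image (can_inj (@mxtens_indexK k l))).
apply/subset_leq_card/fintype.subsetP => p /fintype.imageP[[i j] /andP[/= ai bj] {p}->].
rewrite !inE !mxE mxtens_indexK /= subr_eq0.
rewrite !inE in ai bj; have [-> h] := ab (x 0 i) (y 0 j) ai bj; rewrite /= (le_trans h) //.
by rewrite -rmorphXn fmorphV.
Qed.

(** The entries of X being real, X^T is the adjoint of X: it has the same eigenvectors,
with conjugate eigenvalues. *)
Lemma spectrum_conj_diag_trC k (X : 'M[int]_k) (XC := map_mx intr X : 'M[C]_k)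
  (y := spectral_diag XC) (P := spectralmx XC) :
  XC \is normalmx -> map_mx intr X^T = invmx P *m diag_mx (map_mx Num.conj y) *m P.
Proof.
move=> nX.
have XE : XC = invmx P *m diag_mx y *m P by exact: spectral_decomposition.
have uP : P \is unitarymx by exact: spectral_unitarymx.
have -> : map_mx intr X^T = (map_mx Num.conj XC^T) :> 'M[C]_k.
  by apply/matrixP => i j; rewrite /XC !mxE rmorph_int.
rewrite XE invmx_unitary // !trmx_mul !map_mxM map_trmx trmxK -map_mx_comp.
by rewrite tr_diag_mx map_diag_mx (map_mx_id (@conjCK _)) mulmxA.
Qed.

(** The eigenvalues in a give small nonzero eigenvalues z - conj z of X - X^T. *)
Lemma spectrum_few_nonreal k (X : 'M[int]_k) (K B : R) r (a : pred C) :
  (map_mx intr X : 'M[C]_k) \is normalmx ->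
  (forall z, z \in spectrum X -> `|z| <= K%:C) ->
  1 < B -> K + K <= B ->
  (forall z, a z -> z != Num.conj z /\ `|z - Num.conj z| <= (B ^- r)%:C) ->
  (r * count a (spectrum X) <= k)%N.
Proof.
move=> nX bX B1 KB ab; set XC : 'M[C]_k := map_mx intr X.
have uP : spectralmx XC \in unitmx by exact: spectral_unit.
have := spectral_decomposition nX; have := spectrum_conj_diag_trC nX.
rewrite -/XC; set x := spectral_diag XC; set P := spectralmx XC in uP * => XTE XE.
have dE : map_mx intr (X - X^T) = invmx P *m diag_mx (x - map_mx Num.conj x) *m P :> 'M[C]_k.
  by rewrite linearB /= mulmxBr mulmxBl -XTE -XE map_mxD map_mxN.
have B1' : 1 < B%:C :> C by rewrite -[1]/(1%:C) ltcR.
have bd i : `|(x - map_mx Num.conj x) 0 i| <= B%:C.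
  rewrite !mxE (le_trans (ler_normB _ _)) // (@le_trans _ _ (K + K)%:C) ?lecR // rmorphD /=.
  by rewrite norm_conjC; apply: lerD; apply: bX; exact: mem_spectral_diag.
apply: leq_trans (int_conj_diag_few_small r uP dE B1' bd); rewrite leq_mul2l; apply/orP; right.
rewrite /spectrum count_map cardE size_filter count_filter; apply: sub_count => j /andP[/= aj _].
rewrite !inE !mxE subr_eq0.
have [-> h] := ab (x 0 j) aj; rewrite /= (le_trans h) //.
by rewrite -rmorphXn fmorphV.
Qed.

(** For t in N the integer matrix X + t(X - X^T) is diagonal in the same basis as X, with
eigenvalues x + t(x - conj x); it has the real eigenvalue z. Hence w is one of its
eigenvalues: Im w = (1 + 2t) Im x for some eigenvalue x of X, depending on t. For large t
this leaves only Im w = 0. In the application q is the minimal polynomial of z. *)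
Lemma spectrum_real_root k (X : 'M[int]_k) (q : {poly C}) z :
  (map_mx intr X : 'M[C]_k) \is normalmx ->
  z \in spectrum X -> complex.Im z = 0 ->
  (forall p : {poly int}, p \is monic -> root (map_poly intr p) z -> q %| map_poly intr p) ->
  forall w, root q w -> complex.Im w = 0.
Proof.
move=> nX zX z0 qmin w qw.
have uP : spectralmx (map_mx intr X : 'M[C]_k) \in unitmx by exact: spectral_unit.
have := spectral_decomposition nX; have := spectrum_conj_diag_trC nX.
set XC := map_mx intr X; set x := spectral_diag XC; set P := spectralmx XC in uP * => XTE XE.
have key (t : nat) : exists i, w = x 0 i + t%:R * (x 0 i - Num.conj (x 0 i)).
  pose Y := X + t%:Z *: (X - X^T).
  have YE : map_mx intr Y =
      invmx P *m diag_mx (x + t%:R *: (x - map_mx Num.conj x)) *m P :> 'M[C]_k.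
    rewrite linearD linearZ linearB /= mulmxDr mulmxDl -scalemxAr -scalemxAl.
    rewrite mulmxBr mulmxBl -XTE -XE map_mxD map_mxZ map_mxD map_mxN.
    by [].
  have YP := char_poly_conj_diag uP YE.
  have : root (map_poly intr (char_poly Y)) z.
    rewrite map_char_poly YP; have /mapP[i _ zi] := zX; rewrite (bigD1 i) //= rootM.
    rewrite root_XsubC !mxE -/x; apply/orP; left; rewrite -zi -/XC.
    have -> : Num.conj z = z by case: (z) z0 => u v /= ->; apply/CrealP; rewrite complex_real.
    by rewrite subrr mulr0 addr0.
  move=> /(qmin _ (char_poly_monic _)) /dvdpP[q' qE].
  have : root (map_poly intr (char_poly Y)) w by rewrite qE rootM qw orbT.
  rewrite map_char_poly YP -big_enum -(big_map (fun i => 'X - _) predT id).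
  rewrite -[root _ _]negbK root_bigmul -has_predC has_map => /hasP[i _] /=; rewrite negbK.
  rewrite root_XsubC !mxE => /eqP ->; by exists i.
pose N := `|complex.Im w|.
(* Past this t, (1 + 2t) Im x exceeds Im w in modulus for every nonreal x. *)
have zmax : exists t : nat, forall i, complex.Im (x 0 i) != 0 -> N < t%:R * `|complex.Im (x 0 i)|.
  have bnd i : exists t : nat, complex.Im (x 0 i) != 0 -> N < t%:R * `|complex.Im (x 0 i)|.
    have [->|nz] := eqVneq (complex.Im (x 0 i)) 0; first by exists 0%N.
    exists (Num.truncn (N / `|complex.Im (x 0 i)|)).+1 => _.
    by rewrite -ltr_pdivrMr ?normr_gt0 // truncnS_gt.
  have [t tP] := choice bnd.
  exists (\max_i t i) => i nz; apply: lt_le_trans (tP i nz) _.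
  by rewrite ler_wpM2r // ler_nat leq_bigmax.
have [t tP] := zmax; have [i wE] := key t.
have ImE : complex.Im w = (1 + 2 * t%:R) * complex.Im (x 0 i).
  rewrite wE -(rmorph_nat (real_complex R)).
  by case: (x 0 i) => u v /=; ring.
have [xi0|nz] := eqVneq (complex.Im (x 0 i)) 0; first by rewrite ImE xi0 mulr0.
have := tP i nz; rewrite /N ImE normrM ltr_pM2r ?normr_gt0 //.
have t0 : 0 <= t%:R :> R by [].
rewrite ger0_norm; lra.
Qed.
End Spectrum.

(** * Minimal polynomials and Galois conjugates *)

Section Conjugates.
Variable R : realType.
Local Notation C := R[i].
Local Notation toC := (map_poly (ratr : rat -> C)).
Implicit Types (p q m : {poly rat}) (z w : C).

Lemma irreducible_root m q z : irreducible_poly m -> root (toC m) z ->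
  root (toC q) z = (m %| q).
Proof.
move=> irm mz; apply/idP/idP => [qz|/dvdpP[u ->]]; last first.
  by rewrite rmorphM rootM mz orbT.
apply: contraTT qz; rewrite -irreducible_poly_coprime // => cop.
by rewrite /root (coprimep_root _ mz) // coprimep_map.
Qed.

(** By infinite descent: a reducible polynomial with root z has a proper factor with root
z. So the default value in the definition of minpolyQ z is not reached. *)
Lemma minpolyQP p z : p \is monic -> root (toC p) z ->
  [/\ minpolyQ z \is monic, irreducible_poly (minpolyQ z) & root (toC (minpolyQ z)) z].
Proof.
move=> mp pz; rewrite /minpolyQ; case: xgetP => [m _ //|nex].
exfalso; have [n] := ubnP (size p); elim: n p mp pz => // n IHn p mp pz.
rewrite ltnS => sp.
have p1 : (1 < size p)%N.
  rewrite ltnNge; apply/negP => /size1_polyC pE.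
  move: pz; rewrite pE map_polyC rootC fmorph_eq0 => /eqP c0.
  by move: mp; rewrite pE c0 monicE lead_coefC eq_sym oner_eq0.
apply: (nex p); split=> //; split=> // q q1 qp.
have /dvdpP[u pE] := qp.
have p0 : p != 0 by rewrite -size_poly_gt0 (ltn_trans _ p1).
have /andP[u0 q0] : (u != 0) && (q != 0) by rewrite -negb_or -mulf_eq0 -pE.
have small (v v' : {poly rat}) : v != 0 -> v' != 0 -> size v' != 1%N ->
    p = v * v' -> root (toC v) z -> False.
  move=> v0 v'0 v'1 pvv' vz; apply: (IHn ((lead_coef v)^-1 *: v)).
  - by rewrite monicE lead_coefZ mulVf // lead_coef_eq0.
  - by rewrite map_polyZ rootZ // fmorph_eq0 invr_eq0 lead_coef_eq0.
  rewrite size_scale ?invr_eq0 ?lead_coef_eq0 //; apply: leq_trans sp.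
  rewrite pvv' size_mul // -ltnS prednK ?addn_gt0 ?size_poly_gt0 ?v0 //.
  have : (0 < size v')%N by rewrite size_poly_gt0.
  by move: v'1; case: (size v') => [|[|j]] // _ _; rewrite !addnS ltnS leqNgt ltnS; lia.
move: pz; rewrite pE rmorphM rootM => /orP[uz|qz].
  by case: (small u q).
have /eqP u1 : size u == 1%N.
  by apply/negPn/negP => u1; apply: (small q u) => //; rewrite mulrC.
have [c c0 uE] : exists2 c, c != 0 & u = c%:P.
  by move/eqP: u1 => /size_poly1P.
by rewrite uE mul_polyC eqp_sym eqp_scale.
Qed.

Lemma minpolyQ_eq m z : m \is monic -> irreducible_poly m -> root (toC m) z ->
  minpolyQ z = m.
Proof.
move=> mm im mz; have [mm' im' mz'] := minpolyQP mm mz.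
apply/eqP; rewrite -eqp_monic // /eqp -!(irreducible_root _ _ mz) //.
by rewrite mz' -(irreducible_root _ im' mz') mz.
Qed.

(** A multiple root of m is a root of the derivative of m, which is nonzero in
characteristic zero and of smaller degree than m. *)
Lemma irreducible_mup m z : irreducible_poly m -> root (toC m) z -> mup z (toC m) = 1%N.
Proof.
move=> im mz; have m0 := irredp_neq0 im.
have mC0 : toC m != 0 by rewrite map_poly_eq0.
apply/eqP; rewrite eqn_leq mup_leq // mup_geq // expr1 dvdp_XsubCl mz andbT.
apply/negP => /dvdpP[u mE].
have : root (toC m^`()) z.
  rewrite -deriv_map mE derivM expr2 derivM derivXsubC rootE !hornerE /= subrr; apply/eqP; ring.
rewrite (irreducible_root _ im mz) => /dvdp_leq.
have sm : (1 < size m)%N by case: im.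
have d0 : m^`() != 0.
  apply/eqP => /polyP/(_ (size m).-2); rewrite coef_deriv coef0 => /eqP.
  have -> : (size m).-2.+1 = (size m).-1 by move: sm; case: (size m) => [|[]].
  by rewrite mulrn_eq0 -lead_coefE lead_coef_eq0 (negPf m0); move: sm; case: (size m) => [|[]].
by move=> /(_ d0); rewrite leqNgt lt_size_deriv.
Qed.

(** Each division of p by m lowers the multiplicity of all roots of m by one; once m no
longer divides p, none of them is a root of p. *)
Lemma irreducible_mup_conj m p z w : irreducible_poly m ->
  root (toC m) z -> root (toC m) w -> p != 0 -> mup z (toC p) = mup w (toC p).
Proof.
move=> im mz mw; have m0 := irredp_neq0 im.
have [n] := ubnP (size p); elim: n p => [p h|n IHn p]; first by exfalso; rewrite ltn0 in h.
rewrite ltnS => sp p0.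
have [/dvdpP[q pE]|ndvd] := boolP (m %| p); last first.
  by rewrite !mupNroot // (irreducible_root _ im).
have q0 : q != 0 by apply: contraNneq p0 => q0; rewrite pE q0 mul0r.
have toCpE : toC p = toC q * toC m by rewrite pE rmorphM.
have qC0 : toC q != 0 by rewrite map_poly_eq0.
have mC0 : toC m != 0 by rewrite map_poly_eq0.
rewrite toCpE (mupM z qC0 mC0) (mupM w qC0 mC0) (irreducible_mup im mz) (irreducible_mup im mw).
rewrite (IHn q) //.
apply: leq_trans sp; rewrite pE size_mul //.
have sm : (1 < size m)%N by case: im.
by move: sm; case: (size m) => [|[|j]] // _; rewrite !addnS /= ltnS leq_addr.
Qed.

Lemma irreducible_roots m : m \is monic -> irreducible_poly m ->
  exists rs : seq C, [/\ uniq rs, size rs = (size m).-1 & forall z, (z \in rs) = root (toC m) z].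
Proof.
move=> mm im; have [rs] := closed_field_poly_normal (toC m).
rewrite (monicP _) ?map_monic // scale1r => rsE; exists rs.
have memE z : (z \in rs) = root (toC m) z by rewrite rsE root_prod_XsubC.
split=> //; last first.
  by rewrite -(size_map_poly (ratr : {rmorphism rat -> C})) rsE size_prod_XsubC.
apply/count_mem_uniq => z; have := mu_prod_XsubC z rs; rewrite -rsE memE.
have [mz|mz] := boolP (root _ _); first by rewrite irreducible_mup.
by rewrite mupNroot.
Qed.

Lemma galois_conjugate_minpolyQ p z w : p \is monic -> root (toC p) z ->
  galois_conjugate z w -> minpolyQ w = minpolyQ z.
Proof. by move=> mp pz zw; have [mm im _] := minpolyQP mp pz; exact: minpolyQ_eq. Qed.

Lemma map_intr_ratr (p : {poly int}) : map_poly intr p = toC (map_poly intr p).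
Proof. by apply/polyP => i; rewrite !coef_map /= ratr_int. Qed.

Lemma integral_rat z : integralOver (intr : int -> C) z ->
  exists2 p : {poly rat}, p \is monic & root (toC p) z.
Proof.
move=> [p mp pz]; exists (map_poly intr p); first exact: monic_map.
by rewrite -map_intr_ratr.
Qed.

Lemma galois_conjugate_sym z w : integralOver (intr : int -> C) z ->
  galois_conjugate z w -> galois_conjugate w z.
Proof.
move=> /integral_rat[p mp pz] zw.
by rewrite /galois_conjugate (galois_conjugate_minpolyQ mp pz zw); case: (minpolyQP mp pz).
Qed.

Lemma totally_real_conjugates (a : R) : totally_real_integer a ->
  exists rs : seq R, [/\ uniq rs, size rs = algebraic_degree a%:C, (0 < size rs)%N &
    forall b, (b \in rs) = `[< galois_conjugate a%:C b%:C >]].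
Proof.
move=> [/integral_rat[p mp pa] aR]; have [mm im ma] := minpolyQP mp pa.
have [rs [urs srs rsE]] := irreducible_roots mm im.
have reE z : z \in rs -> z = (complex.Re z)%:C.
  rewrite rsE => /aR; by case: z => u v /= ->.
exists (map (@complex.Re R) rs); split; rewrite ?size_map //.
- by rewrite map_inj_in_uniq // => z w /reE -> /reE -> /= ->.
- by rewrite srs; case: im => /= + _; case: size => [|[]].
move=> b; apply/mapP/asboolP => [[z zrs ->]|ab].
  by rewrite /galois_conjugate -rsE -reE.
by exists b%:C => //; rewrite rsE.
Qed.

Lemma count_mem_sum (T : eqType) (rs t : seq T) : uniq rs ->
  count (mem rs) t = (\sum_(c <- rs) count_mem c t)%N.
Proof.
move=> urs; elim: t => [|x t IH] /=; first by rewrite big1.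
rewrite big_split /= -IH; congr addn.
under eq_bigr do rewrite eq_sym.
by rewrite -big_mkcond sum1_count count_uniq_mem.
Qed.

(** The point b of the list receives weight 1 / deg b from each entry a conjugate to it.
There are deg b conjugates, each occurring as often as b does, so in total b receives its
multiplicity. *)
Lemma sum_galois_measure (t : seq R) (B : set R) :
  (forall a, a \in t -> totally_real_integer a) ->
  (forall a b, a \in t -> galois_conjugate a%:C b%:C -> count_mem b t = count_mem a t) ->
  (\sum_(a <- t) galois_measure a B = ((count (mem B) t)%:R : R)%:E)%E.
Proof.
move=> tR tG.
have minpoly_conj a b : a \in t -> galois_conjugate a%:C b%:C ->
    minpolyQ b%:C = minpolyQ a%:C :> {poly rat}.
  move=> /tR[/integral_rat[p mp pa] _]; exact: galois_conjugate_minpolyQ mp pa.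
have mem_conj a b : a \in t -> galois_conjugate a%:C b%:C -> b \in t.
  by move=> at_ ab; rewrite -has_pred1 has_count (tG a b at_ ab) -has_count has_pred1.
pose cj (a b : R) := `[< galois_conjugate a%:C b%:C >].
have cjC a b : a \in t -> b \in t -> cj a b = cj b a.
  move=> at_ bt; apply/asboolP/asboolP => h.
    rewrite /galois_conjugate (minpoly_conj _ _ at_ h).
    by have [/integral_rat[p mp pa] _] := tR _ at_; have [] := minpolyQP mp pa.
  rewrite /galois_conjugate (minpoly_conj _ _ bt h).
  by have [/integral_rat[p mp pa] _] := tR _ bt; have [] := minpolyQP mp pa.
pose d (a : R) : R := (algebraic_degree a%:C)%:R^-1.
have galE a : a \in t -> galois_measure a B =
    (\sum_(b <- undup t | cj a b) d b * (b \in B)%:R)%:E.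
  move=> at_; have [rs [urs srs rs0 rsE]] := totally_real_conjugates (tR a at_).
  rewrite /galois_measure (_ : [set b | _] = [set` rs]); last first.
    by apply/seteqP; split=> b /=; rewrite rsE => /asboolP.
  rewrite -fsbig_seq //= -sumEFin -(big_filter _ (cj a)).
  have prs : perm_eq rs [seq b <- undup t | cj a b].
    apply: uniq_perm => //; first by rewrite filter_uniq ?undup_uniq.
    move=> b; rewrite mem_filter mem_undup rsE; apply/idP/andP => [|[]//].
    by move=> cab; split=> //; apply: mem_conj at_ _; exact/asboolP.
  rewrite (perm_big _ prs) /=; apply: eq_big_seq => b; rewrite mem_filter => /andP[/asboolP cab _].
  rewrite EFinM /dirac /indic /d /algebraic_degree (minpoly_conj a b) //.
rewrite big_seq (eq_bigr _ galE) -big_seq sumEFin; congr (_%:E).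
under eq_bigr do rewrite big_mkcond /=.
rewrite exchange_big /=.
transitivity (\sum_(b <- undup t) (b \in B)%:R *+ count_mem b t : R).
  apply: eq_big_seq => b; rewrite mem_undup => bt.
  rewrite -big_mkcond /= big_const_seq iter_addr_0 -[RHS]mul1r.
  have [rs [urs srs rs0 rsE]] := totally_real_conjugates (tR b bt).
  have -> : count (cj^~ b) t = (size rs * count_mem b t)%N.
    have -> : count (cj^~ b) t = count (mem rs) t.
      by apply: eq_in_count => a at_; rewrite /= rsE cjC.
    rewrite count_mem_sum // (eq_big_seq (fun=> count_mem b t)).
      by rewrite big_const_seq count_predT iter_addn_0 mulnC.
    by move=> c; rewrite rsE => /asboolP; exact: tG.
  rewrite mulrnA -[_ *+ size rs]mulr_natr mulrAC /d -srs mulVf ?mul1r // pnatr_eq0 -lt0n //.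
transitivity (\sum_(b <- t) (b \in B)%:R : R).
  rewrite -[RHS]big_undup_iterop_count; apply: eq_bigr => b _.
  by rewrite Monoid.iteropE iter_addr_0.
elim: t {tR tG mem_conj minpoly_conj cjC galE} => [|b t IH]; first by rewrite big_nil.
by rewrite big_cons IH /= natrD.
Qed.

(** * Conjugates of eigenvalues *)

Lemma spectrum_integral k (X : 'M[int]_k) z :
  (map_mx intr X : 'M[C]_k) \is normalmx -> z \in spectrum R X ->
  integralOver (intr : int -> C) z.
Proof.
move=> nX zX; exists (char_poly X); first exact: char_poly_monic.
by rewrite char_poly_spectrum // root_prod_XsubC.
Qed.

Lemma spectrum_totally_real k (X : 'M[int]_k) z :
  (map_mx intr X : 'M[C]_k) \is normalmx -> z \in spectrum R X -> complex.Im z = 0 ->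
  totally_real_integer (complex.Re z).
Proof.
move=> nX zX z0; have zint := spectrum_integral nX zX.
have zE : (complex.Re z)%:C = z by move: z0; case: (z) => u v /= ->.
rewrite /totally_real_integer zE; split=> // w zw.
have [p0 mp0 p0z] := integral_rat zint; have [mm im mz] := minpolyQP mp0 p0z.
apply: (spectrum_real_root nX zX z0 _ zw) => p mp.
by rewrite map_intr_ratr (irreducible_root _ im mz) dvdp_map.
Qed.

Lemma spectrum_count_conjugate k (X : 'M[int]_k) z w :
  (map_mx intr X : 'M[C]_k) \is normalmx -> z \in spectrum R X -> galois_conjugate z w ->
  count_mem w (spectrum R X) = count_mem z (spectrum R X).
Proof.
move=> nX zX zw; have [p0 mp0 p0z] := integral_rat (spectrum_integral nX zX).
have [mm im mz] := minpolyQP mp0 p0z.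
rewrite -!mu_prod_XsubC -(char_poly_spectrum nX) map_intr_ratr.
apply: (irreducible_mup_conj im zw mz).
by rewrite monic_neq0 // monic_map // char_poly_monic.
Qed.

End Conjugates.

(** * Averages of the measures of conjugacy classes *)

Lemma galois_measure_ge0 (R : realType) (a : R) B : (0 <= galois_measure a B)%E.
Proof.
rewrite /galois_measure; apply: fsume_ge0 => b _.
by rewrite mule_ge0 // lee_fin invr_ge0.
Qed.

(** The combination has weight 1 / size v for each entry of v. *)
Lemma galois_convex_combination_list (R : realType) (v : seq R) : (0 < size v)%N ->
  (forall a, a \in v -> totally_real_integer a) ->
  (forall a b, a \in v -> galois_conjugate a%:C b%:C -> count_mem b v = count_mem a v) ->
  exists nu : set R -> \bar R, galois_convex_combination nu /\
    forall l, distribution_function nu l = (count (fun z => z < l) v)%:R / (size v)%:R.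
Proof.
move=> v0 vR vG.
pose nu := fun B => (\sum_(i < size v) ((size v)%:R^-1 : R)%:E * galois_measure (nth 0%R v i) B)%E.
exists nu; split.
  exists (size v), (fun=> (size v)%:R^-1), (fun i => nth 0 v i); split => //.
  - by rewrite sumr_const card_ord -(mulr_natr (size v)%:R^-1) mulVf // pnatr_eq0 -lt0n.
  - by move=> i; apply: vR; exact: mem_nth.
move=> l; rewrite /distribution_function /nu -ge0_sume_distrr; last first.
  by move=> i _; exact: galois_measure_ge0.
have := sum_galois_measure `]-oo, l[%classic vR vG.
rewrite (big_nth 0%R) big_mkord => ->; rewrite -EFinM /= mulrC; congr (_%:R / _).
by apply: eq_count => z; rewrite /= mem_setE in_itv.
Qed.

Lemma cvg_uniform_norm (R : realType) (f : nat -> R -> R) (g : R -> R) (e : nat -> R) :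
  e @ \oo --> (0 : R) -> (forall n l, `|f n l - g l| <= e n) -> {uniform, f @ \oo --> g}.
Proof.
move=> e0 fg P /uniform_nbhs[E [entE sub]].
move: entE; rewrite -entourage_ballE => -[d /= d0 dE].
have /cvgrPdist_lt/(_ _ d0) := e0; apply: filterS => n en; apply: sub => l _.
apply: dE; rewrite /= /ball /= distrC (le_lt_trans (fg n l)) //.
by rewrite sub0r normrN in en; exact: le_lt_trans (ler_norm _) en.
Qed.

Lemma minpolyQ0 (R : realType) : minpolyQ (0 : R[i]) = 'X.
Proof.
apply: minpolyQ_eq; first exact: monicX.
  by rewrite -['X]subr0 -polyC0; exact: irredp_XsubC.
by rewrite map_polyX rootX.
Qed.

Lemma totally_real_integer0 (R : realType) : totally_real_integer (0 : R).
Proof.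
split; first by exists 'X; rewrite ?monicX // map_polyX rootX.
by move=> w; rewrite /galois_conjugate minpolyQ0 map_polyX rootX => /eqP ->.
Qed.

(** Any combination serves to approximate a vanishing continuous part; the simplest is
the Dirac measure at 0. *)
Lemma galois_convex_combination0 (R : realType) :
  exists nu : set R -> \bar R, galois_convex_combination nu.
Proof.
have [|||nu [h _]] := @galois_convex_combination_list R [:: 0].
- by [].
- by move=> a; rewrite inE => /eqP ->; exact: totally_real_integer0.
- move=> a b; rewrite inE => /eqP ->.
  by rewrite /galois_conjugate minpolyQ0 map_polyX rootX => /eqP [->].
by exists nu.
Qed.

Definition galois_decomposition (R : realType) (F : R -> R) : Prop :=
  exists Ra Rc : R -> R,
  [/\ forall l : R, F l = Ra l + Rc l,
      step_function Ra,
      (forall x : R, jump_point Ra x ->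
         totally_real_integer x /\
         forall y : R, galois_conjugate x%:C y%:C -> jump_point Ra y),
      continuous Rc
    & exists (s : R) (G : R -> R) (nu : nat -> set R -> \bar R),
        [/\ 0 <= s, (forall l : R, Rc l = s * G l),
            (forall n : nat, galois_convex_combination (nu n))
          & {uniform, (fun n => distribution_function (nu n)) @ \oo --> G}]].
(** * Limits of separated finite spectra *)

Section JumpLimits.
Variables (R : realType) (t : nat -> seq R) (k : nat -> nat) (F : R -> R).

(** The list t n is meant to hold the real eigenvalues of a matrix of size k n, so that
the frequencies are relative to the full spectrum and may add up to less than 1. *)
Definition freq (n : nat) (a : pred R) : R := (count a (t n))%:R / (k n)%:R.

Lemma freq_ge0 n a : 0 <= freq n a.
Proof. by rewrite divr_ge0. Qed.

Lemma freq_le n (a b : pred R) : {in t n, subpred a b} -> freq n a <= freq n b.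
Proof.
move=> ab; rewrite ler_wpM2r ?invr_ge0 // ler_nat -!size_filter.
have -> : seq.filter a (t n) = seq.filter a (seq.filter b (t n)).
  by rewrite -filter_predI; apply: eq_in_filter => x xt /=; case: (boolP (a x)) => // /(ab _ xt) ->.
by rewrite size_filter count_size.
Qed.

Lemma eq_freq n (a b : pred R) : {in t n, a =1 b} -> freq n a = freq n b.
Proof. by move=> ab; congr (_%:R / _); exact: eq_in_count. Qed.

(** For a left-continuous distribution function this is the mass F(x+) - F(x) of the
point x. *)
Definition jump (x : R) : R := inf [set F y - F x | y in `]x, +oo[].

Hypothesis F_mono : {homo F : x y / x <= y}.

Lemma jump_has_inf x : has_inf [set F y - F x | y in `]x, +oo[].
Proof.
split; first by exists (F (x + 1) - F x), (x + 1) => //; rewrite /= in_itv /= andbT ltrDl.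
exists 0; move=> z [y /=]; rewrite in_itv /= andbT => xy <-; by rewrite subr_ge0 F_mono // ltW.
Qed.

Lemma jump_ge0 x : 0 <= jump x.
Proof.
apply: lb_le_inf; first by case: (jump_has_inf x).
move=> z [y /=]; rewrite in_itv /= andbT => xy <-; by rewrite subr_ge0 F_mono // ltW.
Qed.

Lemma jump_le x y : x < y -> jump x <= F y - F x.
Proof.
move=> xy; apply: ge_inf; first by case: (jump_has_inf x).
by exists y => //=; rewrite in_itv /= xy.
Qed.

Lemma jump_near (x e : R) : 0 < e -> exists2 y, x < y & F y < F x + jump x + e.
Proof.
move=> e0; have [z [y /=]] := inf_adherent e0 (jump_has_inf x).
rewrite in_itv /= andbT => xy <- h; exists y => //; move: h; rewrite -/(jump x); lra.
Qed.

Hypothesis F_left : forall x e : R, 0 < e -> exists2 y, y < x & F x - e < F y.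
Hypothesis F_bot : forall e : R, 0 < e -> exists x, F x <= e.
Hypothesis F_top : forall e : R, 0 < e -> exists x, 1 - e <= F x.
Hypothesis k_size : forall n, (size (t n) <= k n)%N.
Hypothesis freq_ub : forall l l' e  : R, l < l' -> 0 < e ->
  \forall n \near \oo, freq n (fun z => z < l) <= F l' + e.
Hypothesis freq_lb : forall l l' e : R, l < l' -> 0 < e ->
  \forall n \near \oo, F l - e <= freq n (fun z => z < l').
Hypothesis separated : forall e : R, 0 < e -> exists2 d, 0 < d &
  forall n p (a b : pred R), (forall x y, a x -> b y -> x != y /\ `|x - y| <= d) ->
    freq n a * freq p b <= e.

Lemma freq_itv n x y : x <= y ->
  freq n (fun z => x <= z < y) = freq n (fun z => z < y) - freq n (fun z => z < x).
Proof.
move=> xy; apply/eqP; rewrite eq_sym subr_eq -mulrDl -natrD; apply/eqP; congr (_%:R / _).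
elim: (t n) => //= z s ->.
rewrite addnACA; congr (_ + _)%N.
have [yz|zy] := leP y z; first by rewrite andbF (le_gtF (le_trans xy yz)).
by case: (leP x z).
Qed.

Lemma freq_ball_lb (x d e : R) : 0 < d -> 0 < e ->
  \forall n \near \oo, jump x - e <= freq n (fun z => x - d <= z < x + d).
Proof.
move=> d0 e0; have e2 : 0 < e / 2 by rewrite divr_gt0.
have xd : x - d < x by lra.
have xd2 : x + d / 2 < x + d by lra.
near=> n; rewrite freq_itv; last lra.
have h1 : freq n (fun z => z < x - d) <= F x + e / 2 by near: n; exact: freq_ub.
have h2 : F (x + d / 2) - e / 2 <= freq n (fun z => z < x + d) by near: n; exact: freq_lb.
have : jump x <= F (x + d / 2) - F x by apply: jump_le; lra.
lra.
Unshelve. all: end_near. Qed.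

Lemma isolated (s : seq R) (x d : R) : 0 < d ->
  exists2 d', 0 < d' <= d & forall y, y \in s -> y != x -> d' <= `|y - x|.
Proof.
move=> d0; elim: s => [|z s [d' /andP[d'0 d'd] IH]]; first by exists d; rewrite ?d0 ?lexx.
have [->|zx] := eqVneq z x.
  exists d'; first by rewrite d'0.
  by move=> y; rewrite inE => /orP[/eqP->|ys]; [rewrite eqxx|exact: IH].
exists (Num.min d' `|z - x|); first by rewrite lt_min d'0 normr_gt0 subr_eq0 zx ge_min d'd.
move=> y; rewrite inE => /orP[/eqP-> _|ys yx]; first by rewrite ge_min lexx orbT.
by rewrite ge_min IH.
Qed.

(** Here separation enters. For large n the entries of t n near x have frequency about
jump x. With n fixed, take p such that the entries of t p have frequency about jump x in
a ball around x so small that it contains no entry of t n other than x. Entries of t n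
near but different from x are close to those of t p in that ball and never equal to them,
so the product of the two frequencies is small. As the second factor is not, almost all
entries of t n near x are equal to x. *)
Lemma freq_jump_lb (x e : R) : 0 < e -> \forall n \near \oo, jump x - e <= freq n (pred1 x).
Proof.
move=> e0; have [Je|eJ] := leP (jump x) e.
  by near=> n; rewrite (le_trans _ (freq_ge0 _ _)) // subr_le0.
(* As jump x > e, the factor for t p is at least e / 2; hence the one for t n is at most
   e / 2. *)
have eta0 : 0 < e ^+ 2 / 4 by rewrite divr_gt0 ?exprn_gt0.
have [d d0 sep] := separated eta0.
have d20 : 0 < d / 2 by rewrite divr_gt0.
have e20 : 0 < e / 2 by rewrite divr_gt0.
near=> n.
have cn : jump x - e / 2 <= freq n (fun z => x - d / 2 <= z < x + d / 2).
  by near: n; exact: freq_ball_lb.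
(* d' is the distance from x to the other entries of t n, or less. *)
have [d' /andP[d'0 d'd] iso] := isolated (t n) x d20.
have d'20 : 0 < d' / 2 by rewrite divr_gt0.
have [p _ /(_ p (leqnn p)) /= cp] := freq_ball_lb x d'20 e20.
pose a : pred R := fun z => [&& z \in t n, z != x & x - d / 2 <= z < x + d / 2].
pose b : pred R := fun z => x - d' / 2 <= z < x + d' / 2.
have ab : freq n a * freq p b <= e ^+ 2 / 4.
  apply: sep => y w /and3P[yt yx /andP[y1 y2]] /andP[w1 w2]; split.
    apply: contraTneq (iso y yt yx) => ->; rewrite -ltNge ltr_norml; lra.
  rewrite ler_norml; lra.
have aE : freq n (fun z => x - d / 2 <= z < x + d / 2) = freq n a + freq n (pred1 x).
  rewrite (@eq_freq n a (fun z => (z != x) && (x - d / 2 <= z < x + d / 2))); last first.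
    by move=> z zt /=; rewrite /a zt.
  rewrite -mulrDl -natrD; congr (_%:R / _).
  elim: (t n) => //= z s ->; rewrite addnACA; congr (_ + _)%N.
  have [->|_] := eqVneq z x; last by rewrite addn0.
  have -> : (x - d / 2 <= x < x + d / 2) by apply/andP; split; lra.
  by [].
have bJ : e / 2 <= freq p b by apply: le_trans cp; lra.
have : freq n a * (e / 2) <= e / 2 * (e / 2).
  have -> : e / 2 * (e / 2) = e ^+ 2 / 4 by field.
  by apply: le_trans ab; rewrite ler_wpM2l ?freq_ge0.
rewrite ler_pM2r // => h; lra.
Unshelve. all: end_near. Qed.

Lemma freq_jump_ub (x e : R) : 0 < e -> \forall n \near \oo, freq n (pred1 x) <= jump x + e.
Proof.
move=> e0; have e40 : 0 < e / 4 by rewrite divr_gt0.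
have [y xy Fy] := jump_near x e40; have [z zx Fz] := F_left x e40.
have xy2 : (x + y) / 2 < y by lra.
near=> n.
have h1 : freq n (fun z => z < (x + y) / 2) <= F y + e / 4 by near: n; exact: freq_ub.
have h2 : F z - e / 4 <= freq n (fun z => z < x) by near: n; exact: freq_lb.
have : freq n (pred1 x) <= freq n (fun w => x <= w < (x + y) / 2).
  by apply: freq_le => w _ /= /eqP ->; apply/andP; split; lra.
rewrite freq_itv; last lra.
lra.
Unshelve. all: end_near. Qed.

Lemma cvg_freq_jump x : freq n (pred1 x) @[n --> \oo] --> jump x.
Proof.
apply/cvgrPdist_le => e e0; near=> n; rewrite ler_distlC; apply/andP; split.
  by near: n; exact: freq_jump_lb.
by near: n; exact: freq_jump_ub.
Unshelve. all: end_near. Qed.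

(** For frequencies below points near x this is weak convergence; at a jump x the entries
of t n could still move across x. They do not: since x keeps its full jump in the limit,
the entries in [x, y[ have at least that frequency, and those below x at most F x. *)
Lemma cvg_freq_lt x : freq n (fun z => z < x) @[n --> \oo] --> F x.
Proof.
apply/cvgrPdist_le => e e0; have e40 : 0 < e / 4 by rewrite divr_gt0.
have [y xy Fy] := jump_near x e40; have [z zx Fz] := F_left x e40.
have xy2 : (x + y) / 2 < y by lra.
near=> n.
have h1 : freq n (fun z => z < (x + y) / 2) <= F y + e / 4 by near: n; exact: freq_ub.
have h2 : F z - e / 4 <= freq n (fun z => z < x) by near: n; exact: freq_lb.
have h3 : jump x - e / 4 <= freq n (pred1 x) by near: n; exact: freq_jump_lb.
have : freq n (pred1 x) <= freq n (fun w => x <= w < (x + y) / 2).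
  by apply: freq_le => w _ /= /eqP ->; apply/andP; split; lra.
rewrite freq_itv; last lra.
rewrite ler_distlC => h; apply/andP; split; lra.
Unshelve. all: end_near. Qed.

Lemma freq_le1 n a : freq n a <= 1.
Proof.
rewrite /freq; case: (k n) (k_size n) => [|m] h; first by rewrite invr0 mulr0.
by rewrite ler_pdivrMr // mul1r ler_nat (leq_trans (count_size _ _)).
Qed.

Lemma cvg_freqT : freq n predT @[n --> \oo] --> (1 : R).
Proof.
apply/cvgrPdist_le => e e0; have e20 : 0 < e / 2 by rewrite divr_gt0.
have [x Fx] := F_top e20.
near=> n; rewrite ler_distlC; apply/andP; split; last first.
  by rewrite (le_trans (freq_le1 _ _)) // lerDl ltW.
have h2 : F x - e / 2 <= freq n (fun z => z < x + 1).
  by near: n; apply: freq_lb => //; rewrite ltrDl.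
have : freq n (fun z => z < x + 1) <= freq n predT by exact: freq_le.
lra.
Unshelve. all: end_near. Qed.

Lemma freq_mem_sum n (u : seq R) : uniq u ->
  freq n (mem u) = \sum_(x <- u) freq n (pred1 x).
Proof. by move=> uu; rewrite -mulr_suml -natr_sum /freq count_mem_sum. Qed.

Lemma cvg_freq_mem (u : seq R) : uniq u ->
  freq n (mem u) @[n --> \oo] --> \sum_(x <- u) jump x.
Proof.
move=> uu; under eq_fun do rewrite freq_mem_sum //.
elim: u {uu} => [|x v IH]; rewrite ?big_nil ?big_cons.
  have -> : (fun n => \sum_(x <- [::]) freq n (pred1 x)) = fun=> 0.
    by apply/funext => n; rewrite big_nil.
  exact: cvg_cst.
have -> : (fun n => \sum_(y <- x :: v) freq n (pred1 y)) =
    (fun n => freq n (pred1 x) + \sum_(y <- v) freq n (pred1 y)).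
  by apply/funext => n; rewrite big_cons.
by apply: cvgD => //; exact: cvg_freq_jump.
Qed.

(** Limits of frequencies bound sums of jumps; this takes the place of the additivity of
a measure with distribution function F. *)
Lemma sum_jump_le (a : pred R) c (u : seq R) :
  freq n a @[n --> \oo] --> c -> uniq u -> all a u -> \sum_(x <- u) jump x <= c.
Proof.
move=> ac uu /allP au; apply: (ler_cvg_to (cvg_freq_mem uu) ac).
by near=> n; apply: freq_le => x _ /= /au.
Unshelve. all: end_near. Qed.

(** * Atomic and continuous parts of the limit *)

Definition atomic_mass (A : set R) : R := fine (\esum_(x in A) (jump x)%:E).

Lemma fsbig_jump (X : set R) : finite_set X ->
  (\sum_(x \in X) (jump x)%:E)%E = (\sum_(x <- fset_set X) jump x)%:E.
Proof. by move=> fX; rewrite fsbig_finite // sumEFin. Qed.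

Lemma esum_jump_le (A : set R) (a : pred R) c : freq n a @[n --> \oo] --> c ->
  (forall x, A x -> a x) -> (\esum_(x in A) (jump x)%:E <= c%:E)%E.
Proof.
move=> ac Aa; apply: ub_ereal_sup => _ [X [fX XA] <-].
rewrite fsbig_jump // lee_fin (sum_jump_le ac) ?fset_uniq //.
by apply/allP => x; rewrite in_fset_set // inE => /XA/Aa.
Qed.

Lemma atomic_massE A : (atomic_mass A)%:E = (\esum_(x in A) (jump x)%:E)%E.
Proof.
rewrite fineK // ge0_fin_numE; last by apply: esum_ge0 => x _; rewrite lee_fin jump_ge0.
by apply: le_lt_trans (ltry 1); apply: esum_jump_le cvg_freqT _.
Qed.

Lemma atomic_mass_ge0 A : 0 <= atomic_mass A.
Proof. by rewrite -lee_fin atomic_massE; apply: esum_ge0 => x _; rewrite lee_fin jump_ge0. Qed.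

Lemma atomic_mass_le (A : set R) (a : pred R) c : freq n a @[n --> \oo] --> c ->
  (forall x, A x -> a x) -> atomic_mass A <= c.
Proof. by move=> ac Aa; rewrite -lee_fin atomic_massE (esum_jump_le ac). Qed.

Lemma atomic_massID B A : atomic_mass A = atomic_mass (A `&` B) + atomic_mass (A `&` ~` B).
Proof.
apply: EFin_inj; rewrite EFinD !atomic_massE; apply: esumID => x _.
by rewrite lee_fin jump_ge0.
Qed.

Lemma sum_atomic_mass (A : set R) (u : seq R) : uniq u -> (forall x, x \in u -> A x) ->
  \sum_(x <- u) jump x <= atomic_mass A.
Proof.
move=> uu uA; rewrite -lee_fin atomic_massE; apply: esum_ge.
exists [set` u]; first by split; [exact: finite_seq|move=> x /= /uA].
by rewrite -fsbig_seq // sumEFin.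
Qed.

Lemma jump_atomic_mass (A : set R) x : A x -> jump x <= atomic_mass A.
Proof.
move=> Ax; rewrite -[jump x](big_seq1 +%R x jump); apply: sum_atomic_mass => // y.
by rewrite inE => /eqP ->.
Qed.

Lemma atomic_mass_adherent (A : set R) (e : R) : 0 < e ->
  exists u : seq R, [/\ uniq u, forall x, x \in u -> A x &
    atomic_mass A - e <= \sum_(x <- u) jump x].
Proof.
move=> e0; have : (atomic_mass A - e < atomic_mass A)%R by lra.
rewrite -lte_fin atomic_massE => /ereal_sup_gt[_ [X [fX XA] <-]].
rewrite fsbig_jump // lte_fin => h; exists (fset_set X); split; rewrite ?fset_uniq ?ltW //.
by move=> x; rewrite in_fset_set // inE => /XA.
Qed.

Definition Fa (l : R) := atomic_mass `]-oo, l[.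
Definition Fc (l : R) := F l - Fa l.
(** The limit of Fc at +oo, the total mass 1 less that of the atoms. *)
Definition Fc_mass := 1 - atomic_mass setT.

Lemma atomic_mass_itv x y : x <= y -> Fa y = Fa x + atomic_mass `[x, y[.
Proof.
move=> xy; rewrite /Fa (atomic_massID `]-oo, x[ `]-oo, y[); congr (atomic_mass _ + atomic_mass _).
  apply/seteqP; split=> z /=; rewrite !in_itv /=; first by case.
  by move=> zx; split=> //; exact: lt_le_trans xy.
apply/seteqP; split=> z /=; rewrite !in_itv /=.
  by case=> -> /negP; rewrite -leNgt => ->.
by move=> /andP[xz ->]; split=> //; apply/negP; rewrite -leNgt.
Qed.

Lemma cvg_freq_itv x y : x <= y ->
  freq n (fun z => x <= z < y) @[n --> \oo] --> F y - F x.
Proof.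
move=> xy; under eq_fun do rewrite freq_itv //.
by apply: cvgB; exact: cvg_freq_lt.
Qed.

(** The atoms in [x, y[ weigh at most F y - F x. *)
Lemma Fc_mono : {homo Fc : x y / x <= y}.
Proof.
move=> x y xy; rewrite /Fc (atomic_mass_itv xy).
have : atomic_mass `[x, y[ <= F y - F x.
  by apply: atomic_mass_le (cvg_freq_itv xy) _ => z /=; rewrite in_itv.
lra.
Qed.

Lemma Fc_ge0 x : 0 <= Fc x.
Proof.
rewrite /Fc /Fa subr_ge0. apply: atomic_mass_le (@cvg_freq_lt x) _ => z /=.
by rewrite in_itv.
Qed.

Lemma Fc_le x : Fc x <= F x.
Proof. by rewrite lerBlDr lerDl atomic_mass_ge0. Qed.

(** The atoms at or to the right of x weigh at most 1 - F x. *)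
Lemma Fc_mass_lb x : Fc_mass - (1 - F x) <= Fc x <= Fc_mass.
Proof.
have -> : Fc_mass = 1 - Fa x - atomic_mass `[x, +oo[.
  rewrite /Fc_mass (atomic_massID `]-oo, x[) setTI -addrA -opprD; congr (_ - (_ + atomic_mass _)).
  rewrite setTI; apply/seteqP; split=> z /=; rewrite !in_itv /= andbT.
    by move=> /negP; rewrite -leNgt.
  by move=> xz; apply/negP; rewrite -leNgt.
have : atomic_mass `[x, +oo[ <= 1 - F x.
  have cv : freq n predT - freq n (fun z => z < x) @[n --> \oo] --> 1 - F x.
    by apply: cvgB; [exact: cvg_freqT|exact: cvg_freq_lt].
  have E n : freq n predT - freq n (fun z => z < x) = freq n (fun z => x <= z).
    rewrite -mulrBl; congr (_ / _); rewrite -natrB ?count_size ?count_predT //.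
    congr (_%:R); rewrite -[size _](count_predC (fun z => z < x)) addKn.
    by apply: eq_count => z /=; rewrite leNgt.
  rewrite (funext E) in cv.
  by apply: atomic_mass_le cv _ => z /=; rewrite in_itv /= andbT.
have := atomic_mass_ge0 `[x, +oo[.
by rewrite /Fc; move=> *; apply/andP; split; lra.
Qed.

(** F is left-continuous and jumps by jump x immediately to the right of x; so does Fa,
which counts the atom x from there on. *)
Lemma Fc_continuous : continuous Fc.
Proof.
move=> x; apply/cvgrPdist_le => e e0.
have [y xy Fy] := jump_near x e0; have [z zx Fz] := F_left x e0.
near=> w; have [xw|wx] := leP x w.
  have wy : w < y by near: w; exact: lt_nbhsl.
  have := Fc_mono xw; have := F_mono (ltW wy).
  have [->|xw'] := eqVneq w x; first by move=> _ _; rewrite subrr normr0; exact: ltW.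
  have : jump x <= atomic_mass `[x, w[.
    by apply: jump_atomic_mass; rewrite /= in_itv /= lexx lt_neqAle eq_sym xw'.
  rewrite ler_norml /Fc (atomic_mass_itv xw) => *; apply/andP; split; lra.
have zw : z < w by near: w; exact: lt_nbhsr.
have := Fc_mono (ltW wx); have := F_mono (ltW zw).
have := atomic_mass_ge0 `[w, x[.
rewrite ler_norml /Fc (atomic_mass_itv (ltW wx)) => *; apply/andP; split; lra.
Unshelve. all: end_near. Qed.

Lemma jump_point_Fa x : jump_point Fa x -> 0 < jump x.
Proof.
move=> nc; rewrite lt_neqAle jump_ge0 andbT eq_sym; apply/eqP => J0; apply: nc.
apply/cvgrPdist_le => e e0.
have [y xy Fy] := jump_near x e0; have [z zx Fz] := F_left x e0.
near=> w; have [xw|wx] := leP x w.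
  have wy : w < y by near: w; exact: lt_nbhsl.
  have := Fc_mono xw; have := F_mono (ltW wy); have := atomic_mass_ge0 `[x, w[.
  rewrite ler_norml /Fc (atomic_mass_itv xw) => *; apply/andP; split; lra.
have zw : z < w by near: w; exact: lt_nbhsr.
have := Fc_mono (ltW wx); have := F_mono (ltW zw).
have := atomic_mass_ge0 `[w, x[.
rewrite ler_norml /Fc (atomic_mass_itv (ltW wx)) => *; apply/andP; split; lra.
Unshelve. all: end_near. Qed.

Lemma jump_jump_point x : 0 < jump x -> jump_point Fa x.
Proof.
move=> J0 /cvgrPdist_lt/(_ _ J0)[d /= d0 /(_ (x + d / 2))].
rewrite /ball_ /= => /(_ _); have : `|x - (x + d / 2)| < d by rewrite ltr_norml; lra.
move=> h /(_ h); rewrite (@atomic_mass_itv x (x + d / 2)); last lra.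
have : jump x <= atomic_mass `[x, x + d / 2[.
  by apply: jump_atomic_mass; rewrite /= in_itv /= lexx ltrDl divr_gt0.
rewrite ltr_norml; lra.
Qed.

Lemma Fa_step : step_function Fa.
Proof.
exists jump; split; first exact: jump_ge0.
  by rewrite -atomic_massE ltry.
by move=> l; rewrite /Fa atomic_massE.
Qed.

(** By the intermediate value theorem Fc takes finitely many equidistant levels between 0
and Fc_mass; points where it does so cut the line into intervals on which Fc varies
little. To the left and to the right of all of them Fc is close to its limits 0 and
Fc_mass, which gives the two other cases. The lemma turns estimates at the points of g
into uniform ones for monotone functions. *)
Lemma Fc_grid (e : R) : 0 < e -> exists g : seq R, forall l,
  (Fc l <= e \/ exists x, [/\ x \in g, x <= l & Fc l <= Fc x + e]) /\
  (Fc_mass <= Fc l + e \/ exists x, [/\ x \in g, l <= x & Fc x <= Fc l + e]).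
Proof.
move=> e0; pose d := e / 2; have d0 : 0 < d by rewrite divr_gt0.
have d20 : 0 < d / 2 by rewrite divr_gt0.
have [b Fb] := F_bot d20; have [c Fc1] := F_top d20.
pose M := (Num.truncn (Fc_mass / d)).+1.
(* A level outside of this range may not be taken, and 0 is a dummy. *)
have val i : exists x, d <= i%:R * d <= Fc_mass - d -> Fc x = i%:R * d.
  have [h|_] := boolP (d <= i%:R * d <= Fc_mass - d); last by exists 0.
  move: (i%:R * d) h => v /andP[h1 h2].
  have /andP[c1 c2] := Fc_mass_lb c; have b1 := Fc_le b.
  have bc : b <= c.
    rewrite leNgt; apply/negP => cb; have := Fc_mono (ltW cb); lra.
  have [x _ xE] : exists2 x, x \in `[b, c] & Fc x = v.
    apply: IVT => //; first by apply: continuous_subspaceT; exact: Fc_continuous.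
    by rewrite ge_min le_max; apply/andP; split; apply/orP; [left|right]; lra.
  by exists x.
have [xi xiE] := choice val.
exists [seq xi i | i <- iota 0 M] => l.
have Fl0 := Fc_ge0 l; have /andP[_ FlM] := Fc_mass_lb l.
have dn : 0 <= Fc l / d by rewrite divr_ge0 // ltW.
have /andP[j1 j2] := truncn_itv dn; set j := Num.truncn _ in j1 j2.
rewrite ler_pdivlMr // in j1; rewrite ltr_pdivrMr // in j2.
rewrite -natr1 mulrDl mul1r in j2.
have gM i : i%:R * d <= Fc_mass -> xi i \in [seq xi i | i <- iota 0 M].
  move=> h; apply/mapP; exists i => //; rewrite mem_iota /= add0n ltnS.
  have Md : 0 <= Fc_mass / d by apply: divr_ge0; [exact: le_trans FlM|exact: ltW].
  by rewrite truncn_ge_nat // ler_pdivlMr.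
have eE : e = d + d by rewrite /d; field.
split.
  have [|h] := leP (Fc l) e; [by left|right].
  (* The level j - 1 and not j: if Fc l is exactly the level j, then a point at that
     level could lie to the right of l. *)
  have j0 : (1 < j)%N.
    rewrite -(ltr_nat R) -(ltr_pM2r d0) mul1r; move: (_ * d) j1 j2 => v *; lra.
  have jE : j%:R = (j.-1)%:R + 1 :> R by rewrite natr1 prednK // ltnW.
  have jm1 : (1 : R) <= (j.-1)%:R by rewrite ler1n; case: (j) j0.
  have d1 : d <= (j.-1)%:R * d by rewrite -[leLHS]mul1r ler_pM2r.
  rewrite jE mulrDl mul1r in j1 j2.
  have xE : Fc (xi j.-1) = (j.-1)%:R * d.
    apply: xiE; move: (_ * d) d1 j1 j2 => v *; apply/andP; split; lra.
  exists (xi j.-1); rewrite xE; split.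
  - apply: gM; move: (_ * d) d1 j1 j2 => v *; lra.
  - rewrite leNgt; apply/negP => /ltW/Fc_mono; rewrite xE.
    move: (_ * d) d1 j1 j2 => v *; lra.
  - move: (_ * d) d1 j1 j2 => v *; lra.
have [|h] := leP Fc_mass (Fc l + e); [by left|right].
have j3 : 0 <= j%:R * d by rewrite mulr_ge0 // ltW.
have xE : Fc (xi j.+1) = (j.+1)%:R * d.
  apply: xiE; rewrite -natr1 mulrDl mul1r.
  move: (_ * d) j1 j2 j3 => v *; apply/andP; split; lra.
exists (xi j.+1); rewrite xE; split; rewrite -?natr1 ?mulrDl ?mul1r.
- apply: gM; rewrite -natr1 mulrDl mul1r; move: (_ * d) j1 j2 j3 => v *; lra.
- rewrite leNgt; apply/negP => /ltW/Fc_mono; rewrite xE -natr1 mulrDl mul1r.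
  move: (_ * d) j1 j2 j3 => v *; lra.
- move: (_ * d) j1 j2 j3 => v *; lra.
Qed.

(** * Approximation of the continuous part *)

Hypothesis t_real : forall n x, x \in t n -> totally_real_integer x.
Hypothesis t_conj : forall n x y, x \in t n -> galois_conjugate x%:C y%:C ->
  count_mem y (t n) = count_mem x (t n).

Lemma jump_gt0_mem x : 0 < jump x -> \forall n \near \oo, x \in t n.
Proof.
move=> J0; have J20 : 0 < jump x / 2 by rewrite divr_gt0.
near=> n; have : jump x - jump x / 2 <= freq n (pred1 x) by near: n; exact: freq_jump_lb.
move=> h; have : 0 < freq n (pred1 x) by lra.
rewrite -has_pred1 has_count; apply: contraTT; rewrite -leqNgt leqn0 => /eqP c0.
by rewrite /freq c0 mul0r ltxx.
Unshelve. all: end_near. Qed.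

Lemma jump_gt0_totally_real x : 0 < jump x -> totally_real_integer x.
Proof. by move=> /jump_gt0_mem[n _ /(_ n (leqnn n))]; exact: t_real. Qed.

(** A list t n that contains x contains y equally often, so the frequencies of x and y
have the same limit. *)
Lemma jump_conj x y : 0 < jump x -> galois_conjugate x%:C y%:C -> jump y = jump x.
Proof.
move=> J0 xy; apply: (@cvg_unique _ _ (freq n (pred1 y) @[n --> \oo])) => //.
  exact: cvg_freq_jump.
apply: cvg_trans (@cvg_freq_jump x); apply: near_eq_cvg.
near=> n; rewrite /freq (@t_conj n x y) //; near: n; exact: jump_gt0_mem J0.
Unshelve. all: end_near. Qed.

(** More than 1 / tau jumps of size tau would add up to more than the total mass. *)
Lemma large_jumps (tau : R) : 0 < tau ->
  exists2 u : seq R, uniq u & forall x, (x \in u) = (tau <= jump x).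
Proof.
move=> tau0; have fS : finite_set [set x | tau <= jump x].
  apply: contrapT => /infinite_set_fset - /(_ (Num.truncn tau^-1).+1)[B BS sB].
  have := sum_jump_le cvg_freqT (fset_uniq B) (all_predT _).
  apply/negP; rewrite -ltNge.
  apply: (@lt_le_trans _ _ (\sum_(x <- B) tau)); last first.
    rewrite big_seq [leRHS]big_seq; apply: ler_sum => x xB; exact: BS.
  rewrite big_const_seq count_predT iter_addr_0 -mulr_natr -ltr_pdivrMl // mulr1.
  by apply: lt_le_trans (truncnS_gt _) _; rewrite ler_nat.
exists (fset_set [set x | tau <= jump x]); first exact: fset_uniq.
by move=> x; rewrite in_fset_set //; apply/idP/idP; rewrite in_setE.
Qed.

(** Take finitely many atoms w that miss little of the atomic mass, and tau so small that
the atoms of w with jump below tau have little mass together. Enlarging w to all jumps of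
size at least tau makes the set closed under conjugation. *)
Lemma large_jumps_mass (e : R) : 0 < e -> exists tau (u : seq R),
  [/\ 0 < tau, uniq u, forall x, (x \in u) = (tau <= jump x) &
      atomic_mass setT - e <= \sum_(x <- u) jump x].
Proof.
move=> e0; have e20 : 0 < e / 2 by rewrite divr_gt0.
have [w [uw _ wE]] := atomic_mass_adherent setT e20.
pose tau := e / 2 / (size w).+1%:R; have tau0 : 0 < tau by rewrite divr_gt0.
have [u uu uE] := large_jumps tau0; exists tau, u; split=> //.
have wtau : \sum_(x <- w | x \notin u) jump x <= e / 2.
  apply: (@le_trans _ _ (\sum_(x <- w | x \notin u) tau)).
    by apply: ler_sum => x; rewrite uE -ltNge => /ltW.
  rewrite big_const_seq iter_addr_0 -[_ *+ count _ _]mulr_natr /tau -mulrA ler_piMr ?(ltW e20) //.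
  by rewrite mulrC ler_pdivrMr // mul1r ler_nat (leq_trans (count_size _ _)).
have : \sum_(x <- w | x \in u) jump x <= \sum_(x <- u) jump x.
  rewrite -big_filter; apply: (@le_trans _ _ (\sum_(x <- u | x \in w) jump x)).
    rewrite -[leRHS]big_filter (perm_big [seq x <- u | x \in w]) //.
    apply: uniq_perm; rewrite ?filter_uniq // => x.
    by rewrite !mem_filter andbC.
  by rewrite big_mkcond; apply: ler_sum => x _; case: ifP => // _; exact: jump_ge0.
move: wE; rewrite (bigID (mem u)) /=; lra.
Qed.

Lemma cvg_freq_lt_notin (u : seq R) l : uniq u ->
  freq n (fun z => (z < l) && (z \notin u)) @[n --> \oo] -->
    F l - \sum_(x <- u | x < l) jump x.
Proof.
move=> uu; rewrite -big_filter.
have E n : freq n (fun z => (z < l) && (z \notin u)) =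
    freq n (fun z => z < l) - freq n (mem [seq x <- u | x < l]).
  apply/eqP; rewrite eq_sym subr_eq -mulrDl -natrD; apply/eqP; congr (_%:R / _).
  elim: (t n) => //= z s ->; rewrite addnACA; congr (_ + _)%N.
  by rewrite mem_filter; case: (z < l); case: (z \in u).
rewrite (funext E); apply: cvgB; first exact: cvg_freq_lt.
by apply: cvg_freq_mem; exact: filter_uniq.
Qed.

Lemma cvg_freq_notin (u : seq R) : uniq u ->
  freq n (fun z => z \notin u) @[n --> \oo] --> 1 - \sum_(x <- u) jump x.
Proof.
move=> uu.
have E n : freq n (fun z => z \notin u) = freq n predT - freq n (mem u).
  apply/eqP; rewrite eq_sym subr_eq -mulrDl -natrD; apply/eqP; congr (_%:R / _).
  by elim: (t n) => //= z s ->; rewrite addnACA; case: (z \in u).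
by rewrite (funext E); apply: cvgB; [exact: cvg_freqT|exact: cvg_freq_mem].
Qed.

(** Delete the large jumps u from t n. The frequency of the rest below l tends to F l
less the large jumps below l, which exceeds Fc l by at most the mass of the small jumps.
This is used at the points of a grid only, and carried over to all l by monotonicity.
That membership in u depends only on the jump makes u closed under conjugation. *)
Lemma Fc_approx_unnormalized (e : R) : 0 < e -> exists n (u : seq R),
  [/\ (forall x, x \in u -> 0 < jump x),
      (forall x y, 0 < jump x -> jump y = jump x -> (x \in u) = (y \in u)),
      `|freq n (fun z => z \notin u) - Fc_mass| <= e
    & forall l, `|freq n (fun z => (z < l) && (z \notin u)) - Fc l| <= e].
Proof.
move=> e0; have e40 : 0 < e / 4 by rewrite divr_gt0.
have [tau [u [tau0 uu uE um]]] := large_jumps_mass e40.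
have [g gP] := Fc_grid e40.
have Fu l : Fc l <= F l - \sum_(x <- u | x < l) jump x <= Fc l + e / 4.
  have h1 : \sum_(x <- u | x < l) jump x <= Fa l.
    rewrite -big_filter; apply: sum_atomic_mass; first exact: filter_uniq.
    by move=> x; rewrite mem_filter /= in_itv => /andP[].
  have h2 : \sum_(x <- u | ~~ (x < l)) jump x <= atomic_mass (setT `&` ~` `]-oo, l[).
    rewrite -big_filter; apply: sum_atomic_mass; first exact: filter_uniq.
    by move=> x; rewrite mem_filter /= in_itv => /andP[/negP].
  move: um; rewrite (bigID (fun x => x < l)) /= (atomic_massID `]-oo, l[) setTI.
  rewrite -/(Fa l) /Fc => *; apply/andP; split; lra.
have mu : Fc_mass <= 1 - \sum_(x <- u) jump x <= Fc_mass + e / 4.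
  have := sum_atomic_mass uu (fun x _ => I : [set: R] x).
  by rewrite /Fc_mass => *; apply/andP; split; lra.
have near_g : \forall n \near \oo, forall x, x \in g ->
    `|freq n (fun z => (z < x) && (z \notin u)) - (F x - \sum_(y <- u | y < x) jump y)| <= e / 4.
  elim: (g) => [|x g' IH]; first by near=> n.
  near=> n => y; rewrite inE => /orP[/eqP ->|].
    near: n; have /cvgrPdist_le/(_ _ e40) := cvg_freq_lt_notin (l := x) uu.
    by apply: filterS => n; rewrite distrC.
  by move: y; near: n.
have near_T : \forall n \near \oo,
    `|freq n (fun z => z \notin u) - (1 - \sum_(y <- u) jump y)| <= e / 4.
  have /cvgrPdist_le/(_ _ e40) := cvg_freq_notin uu.
  by apply: filterS => n; rewrite distrC.
have : \forall n \near \oo, [/\ (forall x, x \in u -> 0 < jump x),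
      (forall x y, 0 < jump x -> jump y = jump x -> (x \in u) = (y \in u)),
      `|freq n (fun z => z \notin u) - Fc_mass| <= e
    & forall l, `|freq n (fun z => (z < l) && (z \notin u)) - Fc l| <= e].
  near=> n.
  have ng : forall x, x \in g ->
    `|freq n (fun z => (z < x) && (z \notin u)) - (F x - \sum_(y <- u | y < x) jump y)| <= e / 4.
    by near: n.
  have nT : `|freq n (fun z => z \notin u) - (1 - \sum_(y <- u) jump y)| <= e / 4.
    by near: n.
  split.
  - by move=> x; rewrite uE; exact: lt_le_trans.
  - by move=> x y J0 xy; rewrite !uE xy.
  - move: nT mu; rewrite !ler_norml => /andP[? ?] /andP[? ?]; apply/andP; split; lra.
  move=> l; have [lo hi] := gP l; rewrite ler_norml; apply/andP; split.
    have Q0 := freq_ge0 n (fun z => (z < l) && (z \notin u)).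
    case: lo => [h|[x [xg xl h]]]; first lra.
    have : freq n (fun z => (z < x) && (z \notin u)) <= freq n (fun z => (z < l) && (z \notin u)).
      by apply: freq_le => z _ /andP[zx ->]; rewrite (lt_le_trans zx xl).
    have := ng x xg; have := Fu x; rewrite ler_norml => /andP[? ?] /andP[? ?]; lra.
  case: hi => [h|[x [xg xl h]]].
    have : freq n (fun z => (z < l) && (z \notin u)) <= freq n (fun z => z \notin u).
      by apply: freq_le => z _ /andP[].
    move: nT mu; rewrite !ler_norml => /andP[? ?] /andP[? ?]; lra.
  have : freq n (fun z => (z < l) && (z \notin u)) <= freq n (fun z => (z < x) && (z \notin u)).
    by apply: freq_le => z _ /andP[zx ->]; rewrite (lt_le_trans zx xl).
  have := ng x xg; have := Fu x; rewrite ler_norml => /andP[? ?] /andP[? ?]; lra.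
by move=> [n _ /(_ n (leqnn n)) h]; exists n, u.
Unshelve. all: end_near. Qed.

(** What is left of t n after the deletion of u still contains conjugate numbers equally
often, because u is a union of conjugacy classes; its normalized counting measure is the
required combination. *)
Lemma Fc_approx (e : R) : 0 < e -> 0 < Fc_mass -> exists nu : set R -> \bar R,
  galois_convex_combination nu /\
  forall l, `|distribution_function nu l - Fc l / Fc_mass| <= e.
Proof.
move=> e0 s0; set s := Fc_mass in s0 *.
(* With error d in both numerator q and denominator Q, where Q >= s / 2, the quotient
   q / Q is off by at most 2 d s / (Q s) <= 4 d / s <= e. *)
pose d := Num.min (s / 2) (e * s / 4).
have d0 : 0 < d by rewrite lt_min !divr_gt0 // mulr_gt0.
have ds : d <= s / 2 by rewrite ge_min lexx.
have de : d <= e * s / 4 by rewrite ge_min lexx orbT.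
have [n [u [uJ uG nT nl]]] := Fc_approx_unnormalized d0.
pose v := [seq z <- t n | z \notin u].
have cntv a : (count a v)%:R / (k n)%:R = freq n (fun z => a z && (z \notin u)).
  by rewrite /freq count_filter.
have szv : (size v)%:R / (k n)%:R = freq n (fun z => z \notin u).
  by rewrite size_filter.
have Q0 : s / 2 <= (size v)%:R / (k n)%:R.
  by rewrite szv; move: nT; rewrite ler_norml => /andP[]; rewrite -/s; lra.
have k0 : (k n)%:R != 0 :> R.
  by apply/eqP => k0; move: Q0; rewrite k0 invr0 mulr0; lra.
have v0 : (0 < size v)%N.
  by rewrite lt0n; apply/eqP => v0; move: Q0; rewrite v0 mul0r; lra.
have v0R : (size v)%:R != 0 :> R by rewrite pnatr_eq0 -lt0n.
have vR a : a \in v -> totally_real_integer a.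
  by rewrite mem_filter => /andP[_]; exact: t_real.
have vG a b : a \in v -> galois_conjugate a%:C b%:C -> count_mem b v = count_mem a v.
  rewrite mem_filter => /andP[au at_] ab.
  have bu : b \notin u.
    apply: contra au => bu; have ba := galois_conjugate_sym (t_real at_).1 ab.
    by rewrite -(uG b a (uJ b bu)) // (jump_conj (uJ b bu) ba).
  rewrite !count_filter -[RHS](eq_count (a1 := pred1 a)); last first.
    by move=> z /=; case: eqVneq => // ->; rewrite au.
  rewrite -[LHS](eq_count (a1 := pred1 b)); last first.
    by move=> z /=; case: eqVneq => // ->; rewrite bu.
  exact: t_conj at_ ab.
have [nu [nuG nuE]] := galois_convex_combination_list v0 vR vG.
exists nu; split=> // l; rewrite nuE.
set c := count _ v; set Q := (size v)%:R / (k n)%:R in szv Q0; pose q : R := c%:R / (k n)%:R.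
have -> : c%:R / (size v)%:R = q / Q by rewrite /q /Q; field; rewrite k0.
have Qp : 0 < Q by lra.
have qF : `|q - Fc l| <= d by rewrite /q cntv.
have QF : `|Q - s| <= d by rewrite szv.
have -> : q / Q - Fc l / s = ((q - Fc l) * s + Fc l * (s - Q)) / (Q * s).
  by field; rewrite !gt_eqF.
rewrite normrM normfV (gtr0_norm (mulr_gt0 Qp s0)) ler_pdivrMr ?(mulr_gt0 Qp s0) //.
have Fl0 := Fc_ge0 l; have /andP[_ FlM] := Fc_mass_lb l.
apply: (@le_trans _ _ (d * s + s * d)).
  rewrite (le_trans (ler_normD _ _)) // !normrM (gtr0_norm s0) (ger0_norm Fl0).
  by rewrite lerD ?ler_wpM2r ?ler_pM // ?(ltW s0) // distrC.
apply: (@le_trans _ _ (e * (s / 2) * s)).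
  have -> : d * s + s * d = (2 * d) * s by ring.
  rewrite ler_pM2r //; lra.
by rewrite [leRHS]mulrA ler_pM2r // ler_pM2l.
Qed.

Lemma integer_limit_decomposition : galois_decomposition F.
Proof.
exists Fa, Fc; split.
- by move=> l; rewrite /Fc addrC subrK.
- exact: Fa_step.
- move=> x /jump_point_Fa J0; split; first exact: jump_gt0_totally_real.
  by move=> y xy; apply: jump_jump_point; rewrite (jump_conj J0 xy).
- exact: Fc_continuous.
have [s0|s0] := ltP 0 Fc_mass; last first.
  have [nu nuG] := galois_convex_combination0 R.
  exists 0, (distribution_function nu), (fun=> nu); split=> //.
    move=> l; rewrite mul0r; apply/eqP; rewrite eq_le Fc_ge0 andbT.
    by have /andP[_ h] := Fc_mass_lb l; exact: le_trans s0.
  by apply: (@cvg_uniform_norm _ _ _ (fun=> 0)); [exact: cvg_cst|move=> n l; rewrite subrr normr0].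
have en n : 0 < n.+1%:R^-1 :> R by rewrite invr_gt0.
have [nu nuP] := choice (fun n => Fc_approx (en n) s0).
exists Fc_mass, (fun l => Fc l / Fc_mass), nu; split; first exact: ltW.
- by move=> l; rewrite mulrCA divff ?mulr1 // gt_eqF.
- by move=> n; case: (nuP n).
- apply: (@cvg_uniform_norm _ _ _ (fun n => n.+1%:R^-1)); first exact: cvg_harmonic.
  by move=> n l; case: (nuP n).
Qed.

End JumpLimits.

(** * Set functions determined on measurable sets *)

Section SetFunctions.
Import HBNNSimple.
Context {d} {T : measurableType d} {R : realType}.

(** The integral is a supremum of integrals of simple functions, which evaluate the set
function on measurable sets only. *)
Lemma eq_integral_set_function (m1 m2 : set T -> \bar R) :
  (forall B, measurable B -> m1 B = m2 B) ->
  forall D f, integral m1 D f = integral m2 D f.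
Proof.
move=> m12 D f; rewrite /integral.
suff E (g : T -> \bar R) : ereal_sup [set sintegral m1 h |
      h in [set h : {nnsfun T >-> R} | forall x, ((h x)%:E <= g x)%E]] =
    ereal_sup [set sintegral m2 h |
      h in [set h : {nnsfun T >-> R} | forall x, ((h x)%:E <= g x)%E]] by rewrite !E.
congr ereal_sup; apply: eq_imagel => h _; rewrite /sintegral.
by apply: eq_fsbigr => x _; rewrite m12 //; exact: measurable_sfunP.
Qed.

(** A measure is nonnegative on all sets, while a set function coming from a spectral
resolution is arbitrary on those that are not Borel; it is replaced by 0 there. *)
Lemma measure_of_set_function (m : set T -> \bar R) :
  m set0 = 0%E -> (forall B, measurable B -> (0 <= m B)%E) ->
  (forall B : nat -> set T, (forall n, measurable (B n)) -> trivIset setT B ->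
     (\sum_(0 <= i < n) m (B i))%E @[n --> \oo] --> m (\bigcup_n B n)) ->
  exists mu : {measure set T -> \bar R}, forall B, measurable B -> m B = mu B.
Proof.
move=> m0 m_ge0 m_add; pose m' B := if `[< measurable B >] then m B else 0%E.
have m'E B : measurable B -> m' B = m B by rewrite /m' => /asboolP ->.
have m'0 : m' set0 = 0%E by rewrite m'E.
have m'_ge0 B : (0 <= m' B)%E by rewrite /m'; case: asboolP => // /m_ge0.
have m'_add : semi_sigma_additive m'.
  move=> B mB tB mUB; rewrite m'E //.
  rewrite (_ : (fun n => _) = (fun n => \sum_(0 <= i < n) m (B i))%E); first exact: m_add.
  by apply/funext => n; apply: eq_bigr => i _; rewrite m'E.
pose mu : {measure set T -> \bar R} :=
  HB.pack m' (isMeasure.Build _ _ _ m' m'0 m'_ge0 m'_add).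
by exists mu => B mB; rewrite /= m'E.
Qed.

End SetFunctions.

(** * Hilbert spaces and spectral resolutions *)

Section Hilbert.
Variable (R : realType) (H : completeNormedModType R[i]) (ip : {dot H for Num.conj}).
Hypothesis hH : hilbert_norm ip.
Local Notation Re := complex.Re.
Local Notation Im := complex.Im.

Lemma ReD (x y : R[i]) : Re (x + y) = Re x + Re y.
Proof. by case: x; case: y. Qed.

Lemma ReB (x y : R[i]) : Re (x - y) = Re x - Re y.
Proof. by case: x; case: y. Qed.

Lemma ImB (x y : R[i]) : Im (x - y) = Im x - Im y.
Proof. by case: x; case: y. Qed.
Lemma ipDl x y z : ip (x + y) z = ip x z + ip y z.
Proof. exact: linearDl. Qed.

Lemma ipBl x y z : ip (x - y) z = ip x z - ip y z.
Proof. exact: linearBl. Qed.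

Lemma ipC x y : ip x y = Num.conj (ip y x).
Proof. by rewrite hermC /= expr0 mul1r. Qed.

Lemma Cauchy_Schwarz x y : `|ip x y| <= `|x| * `|y|.
Proof.
have [->|y0] := eqVneq y 0; first by rewrite linear0r !normr0 mulr0.
have nyy : 0 < ip y y by rewrite dnorm_gt0.
pose a := ip x y / ip y y.
have := dnorm_ge0 ip (x - a *: y).
have -> : ip (x - a *: y) (x - a *: y) = ip x x - `|ip x y| ^+ 2 / ip y y.
  have dE : ip x (a *: y) = `|ip x y| ^+ 2 / ip y y.
    rewrite linearZr_LR /= /a rmorphM fmorphV /= (CrealP (ger0_real (ltW nyy))).
    by rewrite mulrAC normCKC.
  have dr : (ip x (a *: y)) ^* = ip x (a *: y).
    by rewrite dE; apply/CrealP; rewrite realM ?realV ?realX ?normr_real ?(ger0_real (ltW nyy)).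
  rewrite dnormB dr dE dnormZ /a normrM normfV (gtr0_norm nyy).
  by field; rewrite gt_eqF.
rewrite subr_ge0 ler_pdivrMr // -!hH -exprMn => h.
by rewrite -(@ler_pXn2r _ 2) // nnegrE ?mulr_ge0.
Qed.

Lemma cvg_Re_ip (u : nat -> H) (v x : H) : u @ \oo --> v ->
  Re (ip (u n) x) @[n --> \oo] --> Re (ip v x).
Proof.
move=> uv; apply/cvgrPdist_le => e e0.
pose K := Re `|x|; have xK : `|x| = K%:C by rewrite /K RRe_real ?normr_real.
have K0 : 0 <= K by rewrite -ler0c -xK.
have d0 : 0 < (e / (K + 1))%:C by rewrite -[0]/(0%:C) ltcR divr_gt0 // ltr_wpDl.
have /cvgrPdist_lt/(_ _ d0) := uv; apply: filterS => n un.
rewrite -ReB -ipBl -lecR; apply: le_trans (normc_ge_Re _) _.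
apply: le_trans (Cauchy_Schwarz _ _) _; rewrite xK.
apply: (@le_trans _ _ ((e / (K + 1))%:C * K%:C)).
  by rewrite ler_wpM2r ?ler0c // ltW.
rewrite -rmorphM lecR mulrAC ler_pdivrMr ?ltr_wpDl // ler_pM2l // lerDl //.
Qed.

Lemma ip_gt0_eq0 x : Re (ip x x) = 0 -> x = 0.
Proof.
move=> h; apply/eqP; rewrite -(dnorm_eq0 ip); have := dnorm_ge0 ip x.
by case: (ip x x) h => a b /= ->; rewrite lecE /= => /andP[/eqP -> _].
Qed.

Lemma self_adjoint_real (a : H -> H) x : self_adjoint ip a -> Im (ip (a x) x) = 0.
Proof.
move=> sa; have : ip (a x) x = Num.conj (ip (a x) x) by rewrite -ipC sa.
case: (ip (a x) x) => u v [] /= vE; lra.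
Qed.

End Hilbert.

Section SpectralResolution.
Variable (R : realType) (H : completeNormedModType R[i]) (ip : {dot H for Num.conj}).
Hypothesis hH : hilbert_norm ip.
Variable M : set (H -> H).
Hypothesis hM : von_neumann_algebra ip M.
Variables (A : H -> H) (E : set (borelC R) -> H -> H).
Hypothesis hE : spectral_resolution ip M A E.
Local Notation Re := complex.Re.
Local Notation Im := complex.Im.
Implicit Types B C : set (borelC R).

(** Additivity for a sequence of empty sets: the multiples of E set0 x converge. *)
Lemma spectral_set0 x : E set0 x = 0.
Proof.
have t0 : trivIset setT (fun _ : nat => set0 : set (borelC R)).
  by move=> i j _ _ [z []].
have := @spectral_sigma_additive _ _ _ _ _ _ hE _ (fun=> measurable0) t0 x.
rewrite bigcup0 //; set a := E set0 x => h.
have h1 : (fun n => \sum_(0 <= i < n.+1) a) @ \oo --> a.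
  by rewrite (cvg_shiftS (fun n => \sum_(0 <= i < n) a)).
have h0 : (fun n => \sum_(0 <= i < n.+1) a - \sum_(0 <= i < n) a) @ \oo --> a - a.
  exact: cvgB h1 h.
rewrite subrr in h0.
have aE : (fun n => \sum_(0 <= i < n.+1) a - \sum_(0 <= i < n) a) = fun=> a.
  by apply/funext => n; rewrite big_nat_recr //= [_ + a]addrC addrK.
rewrite aE in h0.
have h2 : ((fun=> a) : nat -> H) @ \oo --> a by exact: cvg_cst.
exact: (cvg_unique (@norm_hausdorff _ H) h2 h0).
Qed.

Lemma spectral_setU B C x : measurable B -> measurable C -> B `&` C = set0 ->
  E (B `|` C) x = E B x + E C x.
Proof.
move=> mB mC BC0.
have mBC n : measurable (bigcup2 B C n) by case: n => [|[|n]] //=; exact: measurable0.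
have tBC : trivIset setT (bigcup2 B C) by rewrite -trivIset_bigcup2.
have := @spectral_sigma_additive _ _ _ _ _ _ hE _ mBC tBC x; rewrite bigcup2E => h.
apply: (cvg_unique (@norm_hausdorff _ H) h).
apply: cvg_near_cst; exists 2%N => // n /= n2.
rewrite -(subnKC n2) addSn addSn add0n !big_nat_recl //= big1 ?addr0 //.
by move=> i _; exact: spectral_set0.
Qed.

Lemma spectral_linear B : measurable B -> linear (E B).
Proof. by move=> mB; have [sub _ _] := hM; have [] := sub _ (spectral_in hE mB). Qed.

Lemma spectral_0 B : measurable B -> E B 0 = 0.
Proof.
move=> mB; have := spectral_linear mB 1 0 0; rewrite !scale1r addr0 => h.
by apply: (addrI (E B 0)); rewrite -h addr0.
Qed.

Lemma spectral_comp B C x : measurable B -> measurable C -> E B (E C x) = E (B `&` C) x.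
Proof. by move=> mB mC; rewrite (spectral_setI hE). Qed.

Lemma ip_spectral B x : measurable B -> ip (E B x) x = ip (E B x) (E B x).
Proof.
by move=> mB; rewrite -[in RHS](spectral_self_adjoint hE mB) spectral_comp // setIid.
Qed.

Lemma ip_spectral_ge0 B x : measurable B -> 0 <= ip (E B x) x.
Proof. by move=> mB; rewrite ip_spectral // dnorm_ge0. Qed.

Lemma spectral_positive B : measurable B -> positive_op ip (E B).
Proof. by move=> mB x; rewrite subr0 ip_spectral_ge0. Qed.

Lemma diag_measure_add x (B : nat -> set (borelC R)) :
  (forall n, measurable (B n)) -> trivIset setT B ->
  (\sum_(0 <= i < n) diag_measure ip E x (B i))%E @[n --> \oo] -->
    diag_measure ip E x (\bigcup_n B n).
Proof.
move=> mB tB; rewrite /diag_measure.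
have -> : (fun n => \sum_(0 <= i < n) (Re (ip (E (B i) x) x))%:E)%E =
    (fun n => (Re (ip (\sum_(0 <= i < n) E (B i) x) x))%:E).
  apply/funext => n; rewrite sumEFin; congr (_%:E).
  elim: n => [|n IH]; first by rewrite !big_nil linear0l.
  by rewrite !big_nat_recr //= IH ipDl ReD.
apply: cvg_EFin; first by near=> n.
apply: (@cvg_Re_ip _ _ ip hH); exact: @spectral_sigma_additive _ _ _ _ _ _ hE _ mB tB x.
Unshelve. all: end_near. Qed.

Lemma diag_measure_is_measure x : exists nu : {measure set (borelC R) -> \bar R},
  forall B, measurable B -> diag_measure ip E x B = nu B.
Proof.
apply: measure_of_set_function; last exact: diag_measure_add.
  by rewrite /diag_measure spectral_set0 linear0l.
move=> B mB; rewrite lee_fin; have := ip_spectral_ge0 x mB.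
by rewrite lecE => /andP[].
Qed.

End SpectralResolution.

(** * Borel sets of the complex plane *)

Section ComplexBorel.
Variable R : realType.
Local Notation Re := complex.Re.
Local Notation Im := complex.Im.

Lemma continuous_real_part : continuous (@complex.Re R : R[i]^o -> R).
Proof.
move=> z; apply/(@cvgrPdist_lt _ _ _ _ (nbhs_filter (z : R[i]^o))) => e e0.
have e0' : 0 < e%:C by rewrite -[0]/(0%:C) ltcR.
apply/(@nbhs_ballP _ (R[i]^o)); exists e%:C => // y; rewrite -ball_normE /= => zy.
rewrite -ReB -ltcR; exact: le_lt_trans (normc_ge_Re _) zy.
Qed.

Lemma normc_ge_Im (z : R[i]) : `|Im z|%:C <= `|z|.
Proof.
by case: z => a b /=; rewrite normc_def /= lecR -[leLHS]sqrtr_sqr ler_wsqrtr // lerDr sqr_ge0.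
Qed.

Lemma continuous_imaginary_part : continuous (@complex.Im R : R[i]^o -> R).
Proof.
move=> z; apply/(@cvgrPdist_lt _ _ _ _ (nbhs_filter (z : R[i]^o))) => e e0.
have e0' : 0 < e%:C by rewrite -[0]/(0%:C) ltcR.
apply/(@nbhs_ballP _ (R[i]^o)); exists e%:C => // y; rewrite -ball_normE /= => zy.
rewrite -ImB -ltcR; exact: le_lt_trans (normc_ge_Im _) zy.
Qed.

Lemma measurable_continuousC (f : R[i]^o -> R) : continuous f ->
  measurable_fun [set: borelC R] (f : borelC R -> R).
Proof.
move=> /continuousP cf; apply: (measurability _ (RGenOpens.measurableE R)).
move=> _ [_ [a [b ->] <-]]; rewrite setTI.
by apply: sub_sigma_algebra; apply: cf; exact: interval_open.
Qed.

Lemma measurable_Re : measurable_fun [set: borelC R] (@complex.Re R : borelC R -> R).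
Proof. exact: measurable_continuousC continuous_real_part. Qed.

Lemma measurable_Im : measurable_fun [set: borelC R] (@complex.Im R : borelC R -> R).
Proof. exact: measurable_continuousC continuous_imaginary_part. Qed.

Lemma measurable_half_plane (c : R) : measurable [set z : borelC R | 0 < c * Im z].
Proof.
have mc : measurable_fun setT (fun z : borelC R => c * Im z).
  by apply: measurable_funM => //; exact: measurable_Im.
have := mc measurableT _ (measurable_itv `]0, +oo[); rewrite setTI.
by congr measurable; apply/seteqP; split=> z /=; rewrite in_itv /= andbT.
Qed.

Lemma measurable_real_lt l : measurable [set z : borelC R | Re z < l].
Proof.
have := measurable_Re measurableT (measurable_itv `]-oo, l[); rewrite setTI.
by congr measurable; apply/seteqP; split=> z /=; rewrite in_itv /=.
Qed.

Lemma nonreal_half_planes : [set z : borelC R | Im z != 0] =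
  [set z | 0 < 1 * Im z] `|` [set z | 0 < -1 * Im z].
Proof.
apply/seteqP; split=> z /=.
  by move=> /lt_total/orP[h|h]; [right|left]; lra.
by case=> h; apply/eqP => h'; rewrite h' mulr0 ltxx in h.
Qed.

Lemma measurable_nonreal : measurable [set z : borelC R | Im z != 0].
Proof. by rewrite nonreal_half_planes; apply: measurableU; exact: measurable_half_plane. Qed.

End ComplexBorel.

(** * Spectra of self-adjoint operators *)

(** The integral of g over B is its integral over the whole space, hence 0. *)
Lemma positive_null_set d (T : measurableType d) (R : realType)
    (nu : {measure set T -> \bar R}) (g : T -> R) (B : set T) :
  measurable B -> nu.-integrable setT (EFin \o g) ->
  (\int[nu]_z (g z)%:E = 0)%E -> nu (~` B) = 0%E ->
  (forall z, B z -> 0 < g z) -> nu B = 0%E.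
Proof.
move=> mB ig g0 nB gB.
have := negligible_integral (measurableC mB) measurableT ig nB.
rewrite setTD setCK g0 => /esym intB.
have mg : measurable_fun B (EFin \o g).
  by apply: measurable_funS (measurable_int _ ig).
have : (\int[nu]_(z in B) `|(EFin \o g) z| = 0)%E.
  rewrite -intB; apply: eq_integral => z; rewrite inE => /gB gz.
  by rewrite /= gtr0_norm.
move=> /(ae_eq_integral_abs _ mB mg)[N [mN nN BN]].
apply/eqP; rewrite -measure_le0 -nN; apply: le_measure; rewrite ?inE // => z Bz.
apply: BN => /= /(_ Bz) /eqP; rewrite eqe => /eqP gz.
by have := gB _ Bz; rewrite gz ltxx.
Qed.

Section SelfAdjoint.
Variable (R : realType) (H : completeNormedModType R[i]) (ip : {dot H for Num.conj}).
Hypothesis hH : hilbert_norm ip.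
Variable M : set (H -> H).
Variables (A : H -> H) (E : set (borelC R) -> H -> H).
Hypothesis hE : spectral_resolution ip M A E.
Hypothesis A_self_adjoint : self_adjoint ip A.

(** Let B be the half plane and y = E B x. The measure <E(.) y, y> is carried by B, where
c Im is positive, and the integral of Im with respect to it is Im <A y, y> = 0. So the
measure vanishes, and its value on B is the squared norm of y. *)
Lemma spectral_half_plane_null (c : R) (x : H) :
  E [set z | 0 < c * complex.Im z] x = 0.
Proof.
set B := [set z : borelC R | _]; pose y := E B x.
have mB : measurable B by exact: measurable_half_plane.
have [nu nuE] := diag_measure_is_measure hH hE y.
have intE f : integral (diag_measure ip E y) setT f = integral nu setT f.
  exact: eq_integral_set_function.
have nu_int : nu.-integrable setT (fun z : borelC R => (complex.Im z)%:E).
  have [_] := spectral_integrable hE y; rewrite !unlock => /asboolP[mf foo].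
  by apply/asboolP; split=> //; rewrite -intE.
have nu0 : (\int[nu]_z (complex.Im z)%:E = 0)%E.
  by rewrite -intE (spectral_integral_Im hE) self_adjoint_real.
apply: (ip_gt0_eq0 (ip := ip)).
have nuB : nu B = 0%E.
  apply: (positive_null_set (g := fun z : borelC R => c * complex.Im z)) => //.
  - exact: (integrableZl measurableT c nu_int).
  - under eq_integral do rewrite EFinM.
    by rewrite integralZl // nu0 mule0.
  - rewrite -nuE; last exact: measurableC.
    rewrite /diag_measure /y (spectral_comp hE) //; last exact: measurableC.
    by rewrite setICl (spectral_set0 hE) linear0l.
have := nuB; rewrite -nuE // /diag_measure /y (spectral_comp hE) // setIid => -[].
by rewrite -(ip_spectral hE).
Qed.

End SelfAdjoint.

(** * The trace of a spectral resolution *)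

Section Trace.
Variable (R : realType) (H : completeNormedModType R[i]) (ip : {dot H for Num.conj}).
Hypothesis hH : hilbert_norm ip.
Variable M : set (H -> H).
Hypothesis hM : von_neumann_algebra ip M.
Variable tau : (H -> H) -> R[i].
Hypothesis htau : faithful_normal_trace ip M tau.
Variables (A : H -> H) (E : set (borelC R) -> H -> H).
Hypothesis hE : spectral_resolution ip M A E.
Local Notation Re := complex.Re.
Local Notation Im := complex.Im.
Implicit Types B C : set (borelC R).

Lemma M_E B : measurable B -> M (E B).
Proof. by move=> mB; exact: (spectral_in hE mB). Qed.

Lemma trace0 : tau (fun=> 0) = 0.
Proof.
have ME := M_E measurableT; have := trace_linear htau (-1) ME ME.
rewrite (_ : (fun x => _) = (fun=> 0)); last by apply/funext => x; rewrite scaleN1r addNr.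
by rewrite mulN1r addNr.
Qed.

Lemma trace_spectral_setU B C : measurable B -> measurable C -> B `&` C = set0 ->
  tau (E (B `|` C)) = tau (E B) + tau (E C).
Proof.
move=> mB mC BC; have := trace_linear htau 1 (M_E mB) (M_E mC); rewrite mul1r => <-.
by congr tau; apply/funext => x; rewrite (spectral_setU hE) // scale1r.
Qed.

Definition spectral_mass B : R := Re (tau (E B)).

Lemma spectral_mass_ge0 B : measurable B -> 0 <= spectral_mass B.
Proof.
move=> mB; have := trace_positive htau (M_E mB) (spectral_positive hE mB).
by rewrite lecE => /andP[].
Qed.

Lemma spectral_massU B C : measurable B -> measurable C -> B `&` C = set0 ->
  spectral_mass (B `|` C) = spectral_mass B + spectral_mass C.
Proof. by move=> mB mC BC; rewrite /spectral_mass trace_spectral_setU // ReD. Qed.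

Lemma spectral_mass_bigsetU (B : nat -> set (borelC R)) n :
  (forall n, measurable (B n)) -> trivIset setT B ->
  spectral_mass (\big[setU/set0]_(i < n) B i) = \sum_(0 <= i < n) spectral_mass (B i).
Proof.
move=> mB tB; elim: n => [|n IH].
  rewrite big_ord0 big_nil /spectral_mass (_ : E set0 = fun=> 0) ?trace0 //.
  by apply/funext => x; exact: (spectral_set0 hE).
rewrite big_ord_recr big_nat_recr //= spectral_massU ?IH //.
- by apply: bigsetU_measurable.
- by apply: (@trivIset_bigsetUI _ predT) => //; apply: sub_trivIset tB.
Qed.

Lemma spectral_op_le B C : measurable B -> measurable C -> B `<=` C ->
  op_le ip (E B) (E C).
Proof.
move=> mB mC BC x; have mD := measurableD mC mB.
have -> : E C x = E B x + E (C `\` B) x.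
  rewrite -(spectral_setU hE) ?setDUK // setDE setICA setICr setI0 //.
rewrite addrC addKr; exact: (ip_spectral_ge0 hE).
Qed.

Lemma spectral_bigsetU (B : nat -> set (borelC R)) n x :
  (forall n, measurable (B n)) -> trivIset setT B ->
  E (\big[setU/set0]_(i < n) B i) x = \sum_(0 <= i < n) E (B i) x.
Proof.
move=> mB tB; elim: n => [|n IH]; first by rewrite big_ord0 big_nil (spectral_set0 hE).
rewrite big_ord_recr big_nat_recr //= (spectral_setU hE) ?IH //.
- by apply: bigsetU_measurable.
- by apply: (@trivIset_bigsetUI _ predT) => //; apply: sub_trivIset tB.
Qed.

(** Normality of the trace refers to the order of operators. An upper bound c of the
partial unions satisfies <E(S_n) x, x> <= <c x, x>, and the left-hand side converges by
additivity of E. *)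
Lemma spectral_op_lub (B : nat -> set (borelC R)) :
  (forall n, measurable (B n)) -> trivIset setT B ->
  op_lub ip M [set E (\big[setU/set0]_(i < n) B i) | n in setT] (E (\bigcup_n B n)).
Proof.
move=> mB tB.
have mU : measurable (\bigcup_n B n) by exact: bigcup_measurable.
have mS n : measurable (\big[setU/set0]_(i < n) B i) by apply: bigsetU_measurable.
split.
- exact: M_E.
- exact: (spectral_self_adjoint hE mU).
- move=> _ [n _ <-]; apply: spectral_op_le => //.
  by rewrite -bigcup_mkord; apply: bigcup_subset => i.
move=> c Mc sc cE x; rewrite ipBl lecE; apply/andP; split.
  rewrite ImB.
  by rewrite !self_adjoint_real // ?subr0 //; exact: (spectral_self_adjoint hE mU).
rewrite ReB subr_ge0 /=.
have cv : Re (ip (E (\big[setU/set0]_(i < n) B i) x) x) @[n --> \oo] -->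
    Re (ip (E (\bigcup_n B n) x) x).
  apply: (cvg_Re_ip hH); under eq_fun do rewrite spectral_bigsetU //.
  exact: (@spectral_sigma_additive _ _ _ _ _ _ hE _ mB tB x).
apply: (cvgr_to_le cv); near=> n.
have := cE _ (ex_intro2 _ _ n I erefl) x; rewrite lecE ipBl ReB subr_ge0.
by move=> /andP[].
Unshelve. all: end_near. Qed.

Lemma spectral_mass_sigma_additive (B : nat -> set (borelC R)) :
  (forall n, measurable (B n)) -> trivIset setT B ->
  \sum_(0 <= i < n) spectral_mass (B i) @[n --> \oo] --> spectral_mass (\bigcup_n B n).
Proof.
move=> mB tB; have mU : measurable (\bigcup_n B n) by exact: bigcup_measurable.
pose S n := \big[setU/set0]_(i < n) B i.
have mS n : measurable (S n) by apply: bigsetU_measurable.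
have Smono m n : (m <= n)%N -> S m `<=` S n by exact: subset_bigsetU.
have [ub lub] : isLub [set Re (tau b) | b in [set E (S n) | n in setT]]
    (spectral_mass (\bigcup_n B n)).
  apply: (trace_normal htau); last exact: spectral_op_lub.
  - by move=> _ [n _ <-]; exact: M_E.
  - by move=> _ [n _ <-]; exact: (spectral_positive hE).
  split; first by exists (E (S 0%N)), 0%N.
  move=> _ _ [m _ <-] [n _ <-]; exists (E (S (maxn m n))); split; first by exists (maxn m n).
  - by apply: spectral_op_le => //; apply: Smono; exact: leq_maxl.
  - by apply: spectral_op_le => //; apply: Smono; exact: leq_maxr.
have mass_le m n : (m <= n)%N -> spectral_mass (S m) <= spectral_mass (S n).
  move=> mn; rewrite /S !spectral_mass_bigsetU //.
  rewrite [leRHS](big_cat_nat (n := m)) //= lerDl.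
  by apply: sumr_ge0 => i _; exact: spectral_mass_ge0.
apply/cvgrPdist_le => e e0.
have [n0 n0E] : exists n0, spectral_mass (\bigcup_n B n) - e <= spectral_mass (S n0).
  apply: contrapT => /forallNP h.
  have : ubound [set Re (tau b) | b in [set E (S n) | n in setT]]
      (spectral_mass (\bigcup_n B n) - e).
    by move=> _ [_ [n _ <-] <-]; have /negP := h n; rewrite -ltNge => /ltW.
  by move=> /lub h'; have := h'; rewrite lerBrDr gerDl leNgt e0.
exists n0 => // n /= n0n; rewrite -(spectral_mass_bigsetU n mB tB) -/(S n).
have h1 : spectral_mass (S n) <= spectral_mass (\bigcup_n B n).
  by apply: ub; exists (E (S n)) => //; exists n.
have := mass_le _ _ n0n; rewrite ler_norml => h2; apply/andP; split; lra.
Qed.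

Lemma spectral_mass_is_measure : exists mu : {measure set (borelC R) -> \bar R},
  forall B, measurable B -> spectral_measure tau E B = mu B.
Proof.
apply: measure_of_set_function.
- rewrite /spectral_measure (_ : E set0 = fun=> 0) ?trace0 //.
  by apply/funext => x; exact: (spectral_set0 hE).
- by move=> B mB; rewrite lee_fin; exact: spectral_mass_ge0.
move=> B mB tB; under eq_fun do rewrite sumEFin.
by apply: cvg_EFin; [near=> n|exact: spectral_mass_sigma_additive].
Unshelve. all: end_near. Qed.

Hypothesis A_self_adjoint : self_adjoint ip A.

Lemma spectral_nonreal_null x : E [set z | Im z != 0] x = 0.
Proof.
have UL0 : [set z : borelC R | 0 < 1 * Im z] `&` [set z | 0 < -1 * Im z] = set0.
  by apply/seteqP; split=> z //= [h1 h2]; lra.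
rewrite nonreal_half_planes (spectral_setU hE) //; try exact: measurable_half_plane.
by rewrite !(spectral_half_plane_null hH hE A_self_adjoint) addr0.
Qed.

Lemma spectral_mass_nonreal : spectral_mass [set z | Im z != 0] = 0.
Proof.
rewrite /spectral_mass (_ : E _ = fun=> 0) ?trace0 //.
by apply/funext => x; exact: spectral_nonreal_null.
Qed.

(** The half plane and the half line differ by nonreal points, where E vanishes. *)
Lemma spectral_mass_real_lt l :
  spectral_distribution tau E l = spectral_mass [set z | Re z < l].
Proof.
have mN := @measurable_nonreal R; set N := [set z : borelC R | Im z != 0] in mN.
have mR := measurable_real_lt l; set B := [set z | Re z < l] in mR *.
have -> : spectral_mass B = spectral_mass (B `\` N).
  congr (Re (tau _)); apply/funext => x.
  have mI := measurableI _ _ mR mN; have mD := measurableD mR mN.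
  rewrite -[in LHS](setUIDK B N) (spectral_setU hE) //; last first.
    by rewrite setDE setIACA setICr setI0.
  by rewrite -(spectral_comp hE) // spectral_nonreal_null (spectral_0 hM hE) // add0r.
rewrite /spectral_distribution /spectral_mass; congr (Re (tau (E _))).
apply/seteqP; split=> z /=.
  by move=> [x]; rewrite in_itv /= => xl <-; split=> //=; rewrite /N /= eqxx.
rewrite /N /= => -[zl /negP/negPn/eqP z0]; exists (Re z); first by rewrite in_itv.
by move: z0; case: (z) => a b /= ->.
Qed.

End Trace.

(** * Weak limits of matrix spectra *)

Section MatrixIntegral.
Variable R : realType.

Lemma mx_spectral_measureE k (X : 'M[int]_k) (B : set (borelC R)) :
  mx_spectral_measure (map_mx intr X) B =
  (\sum_(i < k) (k%:R^-1 : R)%:E * \d_(nth 0%R (spectrum R X) i : borelC R) B)%E.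
Proof.
rewrite /mx_spectral_measure /mx_spectral_proj -mulmxA mxtrace_mulC mulmxK ?spectral_unit //.
rewrite mxtrace_diag.
have nthE i : nth 0%R (spectrum R X) (i : 'I_k) =
    spectral_diag (map_mx intr X : 'M[R[i]]_k) 0 i.
  by rewrite (nth_map i) ?size_enum_ord // nth_ord_enum.
rewrite [X in _ * X](_ : _ = (\sum_(i < k) \1_B (nth 0 (spectrum R X) i : borelC R) : R)%:C).
  rewrite -(rmorph_nat (real_complex R)) -fmorphV -rmorphM /= mulr_sumr -sumEFin.
  by apply: eq_bigr => i _; rewrite EFinM.
rewrite rmorph_sum; apply: eq_bigr => i _; rewrite mxE nthE /indic.
by rewrite rmorph_nat.
Qed.

Lemma mx_spectral_integral k (X : 'M[int]_k) (f : R[i]^o -> R) :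
  continuous f -> (forall z, 0 <= f z) ->
  (\int[mx_spectral_measure (map_mx intr X)]_(z in [set: borelC R]) (f z)%:E =
   ((\sum_(z <- spectrum R X) f z) / k%:R)%:E)%E.
Proof.
move=> cf f0; have mf := measurable_continuousC cf.
have k0 : 0 <= (k%:R^-1 : R) by rewrite invr_ge0.
pose m_ i : {measure set (borelC R) -> \bar R} :=
  mscale (NngNum k0) (\d_(nth 0%R (spectrum R X) i : borelC R)).
have -> : mx_spectral_measure (map_mx intr X) = msum m_ k.
  by apply/funext => B; rewrite mx_spectral_measureE.
have mf' : measurable_fun [set: borelC R] (fun z => (f z)%:E) by exact/measurable_EFinP.
rewrite ge0_integral_measure_sum //; last by move=> z _; rewrite lee_fin.
transitivity (\sum_(i < k) (k%:R^-1 * f (nth 0 (spectrum R X) i))%:E)%E.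
  apply: eq_bigr => i _; rewrite ge0_integral_mscale //; last by move=> z _; rewrite lee_fin.
  by rewrite integral_dirac // diracT mul1e EFinM.
rewrite sumEFin -mulr_sumr mulrC (big_nth 0) size_spectrum big_mkord //.
Qed.

End MatrixIntegral.

Section WeakLimit.
Variables (R : realType) (k : nat -> nat) (X : forall n, 'M[int]_(k n)).
Variables (mass : set (borelC R) -> R) (mu : {measure set (borelC R) -> \bar R}).
Hypothesis massE : forall B, measurable B -> (mass B)%:E = mu B.
Hypothesis weak :
  weakly_converges (fun n => mx_spectral_measure (map_mx intr (X n) : 'M[R[i]]_(k n)))
    (fun B => (mass B)%:E).
Local Notation freqC n a := ((count a (spectrum R (X n)))%:R / (k n)%:R : R).

(** The limit I is the integral of f; the lemmas below only need to compare it with the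
masses of sets outside of which f vanishes, or on which it is 1. *)
Lemma weak_limit_cvg (f : R[i]^o -> R) : continuous f -> (forall z, 0 <= f z <= 1) ->
  exists I : R, [/\ (\sum_(z <- spectrum R (X n)) f z) / (k n)%:R @[n --> \oo] --> I,
    forall B : set (borelC R), measurable B -> (forall z, ~ B z -> f z = 0) -> I <= mass B
  & forall B : set (borelC R), measurable B -> (forall z, B z -> f z = 1) -> mass B <= I].
Proof.
move=> cf f01; have f0 z : 0 <= f z by case/andP: (f01 z).
have mf : measurable_fun [set: borelC R] (fun z => (f z)%:E).
  by apply/measurable_EFinP; exact: measurable_continuousC.
have : (exists K : R, forall z, `|f z| <= K).
  by exists 1 => z; have /andP[z0 z1] := f01 z; rewrite ger0_norm.
move=> /(weak cf); rewrite (eq_integral_set_function massE) => cv.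
have ub (B : set (borelC R)) : measurable B -> (forall z, ~ B z -> f z = 0) ->
    (\int[mu]_z (f z)%:E <= (mass B)%:E)%E.
  move=> mB Bf; rewrite massE // -[B]setIT -(integral_indic mu measurableT mB).
  apply: ge0_le_integral => //.
  - by move=> z _; rewrite lee_fin.
  - by apply/measurable_EFinP; exact: measurable_indic.
  move=> z _; rewrite lee_fin indicE; have /andP[_ z1] := f01 z.
  by case: (boolP (z \in B)) => //; rewrite notin_setE => /Bf ->.
have lb (B : set (borelC R)) : measurable B -> (forall z, B z -> f z = 1) ->
    ((mass B)%:E <= \int[mu]_z (f z)%:E)%E.
  move=> mB Bf; rewrite massE // -[B]setIT -(integral_indic mu measurableT mB).
  apply: ge0_le_integral => //.
  - by apply/measurable_EFinP; exact: measurable_indic.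
  move=> z _; rewrite lee_fin indicE.
  by case: (boolP (z \in B)) => //; rewrite inE => /Bf ->.
have fin : (\int[mu]_z (f z)%:E)%E \is a fin_num.
  rewrite ge0_fin_numE; last by apply: integral_ge0 => z _; rewrite lee_fin.
  by apply: le_lt_trans (ltry (mass setT)); apply: ub => // z /(_ Logic.I).
exists (fine (\int[mu]_z (f z)%:E)); split.
- move: cv; rewrite -[X in _ --> X](fineK fin) => /fine_cvg.
  apply: cvg_trans; apply: near_eq_cvg; near=> n.
  by rewrite /= mx_spectral_integral.
- by move=> B mB Bf; rewrite -lee_fin fineK // ub.
- by move=> B mB Bf; rewrite -lee_fin fineK // lb.
Unshelve. all: end_near. Qed.

Lemma weak_limit_ub (f : R[i]^o -> R) (a : pred R[i]) (B : set (borelC R)) (e : R) :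
  continuous f -> (forall z, 0 <= f z <= 1) -> measurable B ->
  (forall z, a z -> f z = 1) -> (forall z, ~ B z -> f z = 0) -> 0 < e ->
  \forall n \near \oo, freqC n a <= mass B + e.
Proof.
move=> cf f01 mB af Bf e0; have [I [cv ub _]] := weak_limit_cvg cf f01.
have IB := ub B mB Bf.
have : \forall n \near \oo, (\sum_(z <- spectrum R (X n)) f z) / (k n)%:R <= I + e.
  have /cvgrPdist_le/(_ _ e0) := cv; apply: filterS => n.
  by rewrite ler_distlC => /andP[].
apply: filterS => n; move=> h; apply: (@le_trans _ _ (I + e)); last by rewrite lerD2r.
apply: le_trans h; rewrite ler_wpM2r ?invr_ge0 // -sum1_count natr_sum big_mkcond.
apply: ler_sum => z _; have /andP[z0 _] := f01 z.
by case: ifP => // /af ->.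
Qed.

Lemma weak_limit_lb (f : R[i]^o -> R) (a : pred R[i]) (B : set (borelC R)) (e : R) :
  continuous f -> (forall z, 0 <= f z <= 1) -> measurable B ->
  (forall z, B z -> f z = 1) -> (forall z, ~~ a z -> f z = 0) -> 0 < e ->
  \forall n \near \oo, mass B - e <= freqC n a.
Proof.
move=> cf f01 mB Bf af e0; have [I [cv _ lb]] := weak_limit_cvg cf f01.
have IB := lb B mB Bf.
have : \forall n \near \oo, I - e <= (\sum_(z <- spectrum R (X n)) f z) / (k n)%:R.
  have /cvgrPdist_le/(_ _ e0) := cv; apply: filterS => n.
  by rewrite ler_distlC => /andP[].
apply: filterS => n; move=> h; apply: (@le_trans _ _ (I - e)); first by rewrite lerD2r.
apply: le_trans h _; rewrite ler_wpM2r ?invr_ge0 // -sum1_count natr_sum [leRHS]big_mkcond.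
apply: ler_sum => z _; have /andP[_ z1] := f01 z.
by case: ifP => // /negbT /af ->.
Qed.

(** The truncation of x to [0, 1], as a combination of absolute values so that continuity
is immediate. *)
Definition clamp (x : R) := (`|x| - `|x - 1| + 1) / 2.

Lemma clamp01 x : 0 <= clamp x <= 1.
Proof.
rewrite /clamp; have [x0|x0] := leP 0 x; have [x1|x1] := leP 0 (x - 1);
rewrite ?(ger0_norm x0) ?(ltr0_norm x0) ?(ger0_norm x1) ?(ltr0_norm x1); apply/andP; split; lra.
Qed.

Lemma clamp0 x : x <= 0 -> clamp x = 0.
Proof. by move=> x0; rewrite /clamp !ler0_norm //; [field|lra]. Qed.

Lemma clamp1 x : 1 <= x -> clamp x = 1.
Proof. by move=> x1; rewrite /clamp !ger0_norm //; [field|lra|lra]. Qed.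

Lemma continuous_clamp : continuous clamp.
Proof.
move=> x; apply: cvgMl; apply: cvgD; last exact: cvg_cst.
apply: cvgB; first exact: norm_continuous.
by apply: cvg_norm; apply: cvgB; [exact: cvg_id|exact: cvg_cst].
Qed.

Lemma continuous_compC (g : R -> R) (h : R[i]^o -> R) :
  continuous g -> continuous h -> continuous (g \o h).
Proof. by move=> cg ch z; apply: continuous_comp; [exact: ch|exact: cg]. Qed.

(** This function is 1 for Re z <= l and 0 for Re z >= l'. *)
Lemma continuous_ramp (l l' : R) :
  continuous (fun z : R[i]^o => clamp ((l' - complex.Re z) / (l' - l))).
Proof.
apply: (@continuous_compC (fun x => clamp ((l' - x) / (l' - l)))); last exact: continuous_real_part.
move=> x; apply: (@continuous_comp _ _ _ (fun x => (l' - x) / (l' - l)) clamp).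
  by apply: cvgMl; apply: cvgB; [exact: cvg_cst|exact: cvg_id].
exact: continuous_clamp.
Qed.

Lemma weak_limit_lt_ub (l l' e : R) : l < l' -> 0 < e ->
  \forall n \near \oo, freqC n (fun z => complex.Re z < l) <= mass [set z | complex.Re z < l'] + e.
Proof.
move=> ll' e0; have d0 : 0 < l' - l by rewrite subr_gt0.
apply: (weak_limit_ub (@continuous_ramp l l')) => //.
- by move=> z; exact: clamp01.
- exact: measurable_real_lt.
- by move=> z zl; apply: clamp1; rewrite ler_pdivlMr // mul1r; lra.
- move=> z /= /negP; rewrite -leNgt => zl; apply: clamp0.
  by rewrite ler_pdivrMr // mul0r subr_le0.
Qed.

Lemma weak_limit_lt_lb (l l' e : R) : l < l' -> 0 < e ->
  \forall n \near \oo, mass [set z | complex.Re z < l] - e <= freqC n (fun z => complex.Re z < l').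
Proof.
move=> ll' e0; have d0 : 0 < l' - l by rewrite subr_gt0.
apply: (weak_limit_lb (@continuous_ramp l l')) => //.
- by move=> z; exact: clamp01.
- exact: measurable_real_lt.
- by move=> z /= zl; apply: clamp1; rewrite ler_pdivlMr // mul1r; lra.
- move=> z; rewrite -leNgt => zl; apply: clamp0.
  by rewrite ler_pdivrMr // mul0r subr_le0.
Qed.

Lemma weak_limit_nonreal (d e : R) : mass [set z | complex.Im z != 0] = 0 ->
  0 < d -> 0 < e -> \forall n \near \oo, freqC n (fun z => d <= `|complex.Im z|) <= e.
Proof.
move=> m0 d0 e0; rewrite -[e]add0r -[X in X + e]m0.
apply: (@weak_limit_ub (fun z => clamp (`|complex.Im z| / d))) => //.
- apply: (@continuous_compC (fun x => clamp (`|x| / d))); last exact: continuous_imaginary_part.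
  move=> x; apply: (@continuous_comp _ _ _ (fun x => `|x| / d) clamp).
    by apply: cvgMl; exact: norm_continuous.
  exact: continuous_clamp.
- by move=> z; exact: clamp01.
- exact: measurable_nonreal.
- by move=> z zd; apply: clamp1; rewrite ler_pdivlMr // mul1r.
- by move=> z /= /negP; rewrite negbK => /eqP ->; rewrite normr0 mul0r clamp0.
Qed.

End WeakLimit.

(** * Real eigenvalues of the approximating matrices *)

Section RealSpectra.
Variables (R : realType) (k : nat -> nat) (X : forall n, 'M[int]_(k n)).
Hypothesis k_gt0 : forall n, (0 < k n)%N.
Hypothesis normalX : forall n, (map_mx intr (X n) : 'M[R[i]]_(k n)) \is normalmx.
Variable K : R.
Hypothesis boundX : forall n, mx_opnorm_le (map_mx intr (X n) : 'M[R[i]]_(k n)) K.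
Local Notation Re := complex.Re.
Local Notation Im := complex.Im.

Definition real_spectrum n : seq R :=
  [seq Re z | z <- spectrum R (X n) & Im z == 0].

Local Notation freqC n a := ((count a (spectrum R (X n)))%:R / (k n)%:R : R).

Lemma count_real_spectrum n (a : pred R) :
  count a (real_spectrum n) = count (fun z => a (Re z) && (Im z == 0)) (spectrum R (X n)).
Proof. by rewrite count_map count_filter. Qed.

Lemma mem_real_spectrum n x : x \in real_spectrum n -> x%:C \in spectrum R (X n).
Proof.
move=> /mapP[z]; rewrite mem_filter => /andP[/eqP z0 zX] ->.
by move: z0 zX; case: z => u v /= ->.
Qed.

Lemma count_mem_real_spectrum n x :
  count_mem x (real_spectrum n) = count_mem x%:C (spectrum R (X n)).
Proof.
rewrite count_real_spectrum; apply: eq_count => -[u v] /=.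
by rewrite eq_complex.
Qed.

Lemma size_real_spectrum n : (size (real_spectrum n) <= k n)%N.
Proof. by rewrite size_map size_filter -{2}(size_spectrum R (X n)) count_size. Qed.

Lemma real_spectrum_totally_real n x : x \in real_spectrum n -> totally_real_integer x.
Proof. by move=> /mem_real_spectrum xX; apply: (spectrum_totally_real (normalX n) xX). Qed.

Lemma real_spectrum_conjugate n x y : x \in real_spectrum n ->
  galois_conjugate x%:C y%:C -> count_mem y (real_spectrum n) = count_mem x (real_spectrum n).
Proof.
move=> /mem_real_spectrum xX xy; rewrite !count_mem_real_spectrum.
exact: spectrum_count_conjugate (normalX n) xX xy.
Qed.

(* It exceeds 1 and bounds the differences of eigenvalues of modulus at most K. *)
Let B := K + K + 2.

Lemma bound_gt1 : 1 < B.
Proof. by have [K0 _] := boundX 0%N; rewrite /B; lra. Qed.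

Lemma boundK z n : z \in spectrum R (X n) -> `|z| <= K%:C.
Proof. exact: spectrum_bounded (normalX n) (boundX n). Qed.

Lemma ex_inv_le (e : R) : 0 < e -> exists2 r, (0 < r)%N & r%:R^-1 <= e.
Proof.
move=> e0; exists (Num.truncn e^-1).+1 => //.
by rewrite invf_ple ?posrE ?ltr0n //; apply: ltW; rewrite truncnS_gt.
Qed.

Lemma real_spectrum_separated (e : R) : 0 < e -> exists2 d : R, 0 < d &
  forall n p (a b : pred R), (forall x y, a x -> b y -> x != y /\ `|x - y| <= d) ->
    freq real_spectrum k n a * freq real_spectrum k p b <= e.
Proof.
move=> e0; have [r r0 re] := ex_inv_le e0.
have B0 : 0 < B by apply: lt_trans bound_gt1.
exists (B ^- r); first by rewrite invr_gt0 exprn_gt0.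
move=> n p a b ab; pose a' (c : pred R) z := c (Re z) && (Im z == 0).
have := @spectrum_separated R _ (X n) _ (X p) K B r (a' a) (a' b) (normalX n) (normalX p)
  (@boundK ^~ n) (@boundK ^~ p) bound_gt1.
rewrite /B lerDl ler0n => /(_ isT) h.
apply: le_trans re; rewrite /freq !count_real_spectrum mulf_div -natrM.
rewrite ler_pdivrMr -?natrM ?ltr0n ?muln_gt0 ?k_gt0 // mulrC ler_pdivlMr ?ltr0n //.
rewrite -natrM ler_nat mulnC; apply: h => -[x x'] [y y'] /andP[/= ax /eqP ->] /andP[/= bw /eqP ->].
have [xy d] := ab x y ax bw; split.
  by apply: contra xy => /eqP[->].
have -> : (x +i* 0) - (y +i* 0) = (x - y)%:C by apply/eqP; rewrite eq_complex /= subrr !eqxx.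
by rewrite normc_def /= expr0n /= addr0 sqrtr_sqr lecR.
Qed.

Lemma few_nonreal (e : R) : 0 < e -> exists2 d : R, 0 < d &
  forall n, freqC n (fun z => 0 < `|Im z| < d) <= e.
Proof.
move=> e0; have [r r0 re] := ex_inv_le e0.
have B0 : 0 < B by apply: lt_trans bound_gt1.
(* Half, because z - conj z is twice the imaginary part of z. *)
exists (B ^- r / 2); first by rewrite divr_gt0 // invr_gt0 exprn_gt0.
move=> n.
have := @spectrum_few_nonreal R _ (X n) K B r (fun z => 0 < `|Im z| < B ^- r / 2) (normalX n)
  (@boundK ^~ n) bound_gt1.
rewrite /B lerDl ler0n => /(_ isT) h.
apply: le_trans re; rewrite ler_pdivrMr ?ltr0n ?k_gt0 // ler_pdivlMl ?ltr0n //.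
rewrite -natrM ler_nat; apply: h => -[x y] /= /andP[y0 yd].
have -> : (x +i* y) - Num.conj (x +i* y) = 0 +i* (y + y).
  by apply/eqP; rewrite eq_complex /= subrr opprK !eqxx.
split.
  apply: contraTneq y0 => /eqP; rewrite eq_complex /= => /andP[_ /eqP yN].
  by rewrite (_ : y = 0) ?normr0 ?ltxx //; lra.
rewrite normc_def /= expr0n /= add0r sqrtr_sqr lecR.
have -> : `|y + y| = `|y| * 2 by rewrite -mulr2n normrMn mulr_natr.
lra.
Qed.

Variable F : R -> R.
Hypothesis F_mono : {homo F : x y / x <= y}.
Hypothesis F_left : forall x e : R, 0 < e -> exists2 y, y < x & F x - e < F y.
Hypothesis F_ub : forall l l' e : R, l < l' -> 0 < e ->
  \forall n \near \oo, freqC n (fun z => Re z < l) <= F l' + e.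
Hypothesis F_lb : forall l l' e : R, l < l' -> 0 < e ->
  \forall n \near \oo, F l - e <= freqC n (fun z => Re z < l').
Hypothesis F_real : forall d e : R, 0 < d -> 0 < e ->
  \forall n \near \oo, freqC n (fun z => d <= `|Im z|) <= e.

Lemma freqC_le n (a b : pred R[i]) : subpred a b -> freqC n a <= freqC n b.
Proof. by move=> ab; rewrite ler_wpM2r ?invr_ge0 // ler_nat sub_count. Qed.

(** Integrality bounds the proportion of nonreal eigenvalues near the real line, and weak
convergence the proportion of those away from it. *)
Lemma near_real (e : R) : 0 < e -> \forall n \near \oo, freqC n (fun z => Im z != 0) <= e.
Proof.
move=> e0; have e20 : 0 < e / 2 by rewrite divr_gt0.
have [d d0 dE] := few_nonreal e20; have := F_real d0 e20.
apply: filterS => n h; apply: (@le_trans _ _ (e / 2 + e / 2)); last by lra.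
apply: le_trans (lerD (dE n) h); rewrite -mulrDl -natrD ler_wpM2r ?invr_ge0 // ler_nat.
rewrite -count_predUI; apply: leq_trans (leq_addr _ _).
apply: sub_count => z /= z0; rewrite normr_gt0 z0 /=.
by case: ltP.
Qed.

Lemma real_spectrum_ub (l l' e : R) : l < l' -> 0 < e ->
  \forall n \near \oo, freq real_spectrum k n (fun z => z < l) <= F l' + e.
Proof.
move=> ll' e0; have := F_ub ll' e0; apply: filterS => n; apply: le_trans.
by rewrite /freq count_real_spectrum; apply: freqC_le => z /= /andP[].
Qed.

(** The nonreal eigenvalues, absent from the real spectrum, are few. *)
Lemma real_spectrum_lb (l l' e : R) : l < l' -> 0 < e ->
  \forall n \near \oo, F l - e <= freq real_spectrum k n (fun z => z < l').
Proof.
move=> ll' e0; have e20 : 0 < e / 2 by rewrite divr_gt0.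
near=> n.
have h1 : F l - e / 2 <= freqC n (fun z => Re z < l') by near: n; exact: F_lb.
have h2 : freqC n (fun z => Im z != 0) <= e / 2 by near: n; exact: near_real.
have : freqC n (fun z => Re z < l') <=
    freq real_spectrum k n (fun z => z < l') + freqC n (fun z => Im z != 0).
  rewrite /freq count_real_spectrum -mulrDl -natrD ler_wpM2r ?invr_ge0 // ler_nat.
  rewrite -count_predUI; apply: leq_trans (leq_addr _ _).
  by apply: sub_count => z /= ->; case: (Im z == 0).
lra.
Unshelve. all: end_near. Qed.

(** No eigenvalue has real part below -K. *)
Lemma F_bot (e : R) : 0 < e -> exists x, F x <= e.
Proof.
move=> e0; exists (- K - 1).
have KK : - K - 1 < - K by lra.
have [n _ /(_ n (leqnn n))] := F_lb KK e0.
rewrite (_ : count _ _ = 0%N) ?mul0r ?subr_le0 //.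
apply/eqP; rewrite -leqn0 leqNgt -has_count; apply/hasPn => z /boundK.
move=> /(le_trans (normc_ge_Re _)); rewrite lecR ler_norml => /andP[zK _].
by rewrite -leNgt.
Qed.

(** All eigenvalues have real part below K + 1. *)
Lemma F_top (e : R) : 0 < e -> exists x, 1 - e <= F x.
Proof.
move=> e0; exists (K + 2).
have KK : K + 1 < K + 2 by lra.
have [n _ /(_ n (leqnn n))] := F_ub KK e0.
rewrite (_ : count _ _ = k n) ?divff ?pnatr_eq0 -?lt0n // ?lerBlDr //.
rewrite -[RHS](size_spectrum R (X n)); apply/eqP; rewrite -all_count; apply/allP => z /boundK.
move=> /(le_trans (normc_ge_Re _)); rewrite lecR ler_norml => /andP[_ zK].
by rewrite (le_lt_trans zK) // ltrDl.
Qed.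

Lemma integer_spectra_decomposition : galois_decomposition F.
Proof.
apply: (@integer_limit_decomposition R real_spectrum k F) => //.
- exact: F_bot.
- exact: F_top.
- exact: size_real_spectrum.
- exact: real_spectrum_ub.
- exact: real_spectrum_lb.
- exact: real_spectrum_separated.
- exact: real_spectrum_totally_real.
- exact: real_spectrum_conjugate.
Qed.

End RealSpectra.

(** * The distribution function of an integer operator *)

Section SpectralDistribution.
Variable (R : realType) (H : completeNormedModType R[i]) (ip : {dot H for Num.conj}).
Hypothesis hH : hilbert_norm ip.
Variable M : set (H -> H).
Hypothesis hM : von_neumann_algebra ip M.
Variable tau : (H -> H) -> R[i].
Hypothesis htau : faithful_normal_trace ip M tau.
Variables (A : H -> H) (E : set (borelC R) -> H -> H).
Hypothesis hE : spectral_resolution ip M A E.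
Hypothesis A_self_adjoint : self_adjoint ip A.
Local Notation F := (spectral_distribution tau E).
Local Notation Re := complex.Re.
Local Notation Im := complex.Im.

Lemma spectral_distribution_mono : {homo F : x y / x <= y}.
Proof.
move=> x y xy; rewrite !(spectral_mass_real_lt hH hM tau hE A_self_adjoint).
have [mu muE] := spectral_mass_is_measure hH htau hE.
rewrite -lee_fin -![(spectral_mass _ _ _)%:E]/(spectral_measure tau E _) !muE.
- apply: le_measure; rewrite ?inE; try exact: measurable_real_lt.
  by move=> z /= zx; exact: lt_le_trans xy.
- exact: measurable_real_lt.
- exact: measurable_real_lt.
Qed.

(** The half planes Re z < x - 1/(n+1) increase to the half plane Re z < x. *)
Lemma spectral_distribution_left (x e : R) : 0 < e ->
  exists2 y, y < x & F x - e < F y.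
Proof.
move=> e0; have [mu muE] := spectral_mass_is_measure hH htau hE.
pose B n := [set z : borelC R | Re z < x - n.+1%:R^-1].
have mB n : measurable (B n) by exact: measurable_real_lt.
have UB : \bigcup_n B n = [set z | Re z < x].
  apply/seteqP; split=> z /=.
    by move=> [n _] /= h; apply: lt_le_trans h _; rewrite gerBl.
  rewrite -subr_gt0 => h; exists (Num.truncn (x - Re z)^-1) => //=.
  rewrite /B /= ltrBrDr -ltrBrDl invf_plt ?posrE ?ltr0n //; exact: truncnS_gt.
have ndB : nondecreasing_seq B.
  move=> m n mn; apply/subsetPset => z /= zm; apply: lt_le_trans zm _.
  by rewrite lerB // lef_pV2 ?posrE ?ltr0n // ler_nat.
have FE y : (F y)%:E = mu [set z | Re z < y].
  rewrite (spectral_mass_real_lt hH hM tau hE A_self_adjoint) -muE //.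
  exact: measurable_real_lt.
have := nondecreasing_cvg_mu (mu := mu) mB (bigcup_measurable (fun n _ => mB n)) ndB.
rewrite UB -FE => /fine_cvg /cvgrPdist_lt/(_ _ e0)[n _ /(_ n (leqnn n))] /=.
rewrite -FE /= => h; exists (x - n.+1%:R^-1); first by rewrite gtrBl.
by move: h; rewrite ltr_norml => /andP[]; lra.
Qed.

End SpectralDistribution.

Theorem theorem5p4 (R : realType) (H : completeNormedModType R[i])
    (ip : {dot H for Num.conj}) (hH : hilbert_norm ip)
    (M : set (H -> H)) (hM : von_neumann_algebra ip M)
    (tau : (H -> H) -> R[i]) (htau : faithful_normal_trace ip M tau)
    (A : H -> H) (E : set (borelC R) -> H -> H)
    (A_self_adjoint : self_adjoint ip A)
    (A_integer : integer_operator ip M tau A E) :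
  exists Ra Rc : R -> R,
    [/\ forall l : R, spectral_distribution tau E l = Ra l + Rc l,
        step_function Ra,
        (forall x : R, jump_point Ra x ->
           totally_real_integer x /\
           forall y : R, galois_conjugate x%:C y%:C -> jump_point Ra y),
        continuous Rc
      & exists (s : R) (G : R -> R) (nu : nat -> set R -> \bar R),
          [/\ 0 <= s, (forall l : R, Rc l = s * G l),
              (forall n : nat, galois_convex_combination (nu n))
            & {uniform, (fun n => distribution_function (nu n)) @ \oo --> G}]].
Proof.
have [_ _ hE [k [X [k0 nX [K bK] weak]]]] := A_integer.
have [mu muE] := spectral_mass_is_measure hH htau hE.
have massE l := spectral_mass_real_lt hH hM tau hE A_self_adjoint l.
apply: (@integer_spectra_decomposition R k X k0 nX K bK).
- exact: (spectral_distribution_mono hH hM htau hE).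
- exact: (spectral_distribution_left hH hM htau hE).
- by move=> l l' e ll' e0; rewrite massE; exact: (weak_limit_lt_ub muE weak).
- by move=> l l' e ll' e0; rewrite massE; exact: (weak_limit_lt_lb muE weak).
- move=> d e; apply: (weak_limit_nonreal muE weak).
  exact: (spectral_mass_nonreal hH htau hE A_self_adjoint).
Qed.
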